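(* Let $m=p+q$ with $p,q\ge1$, $n\ge1$, and let $L(\Lambda;\Delta^+_{\mathrm{st}})$ be a unitary highest weight representation of $\mathfrak g=\mathfrak{sl}(m|n)$ with respect to $\omega=\omega_{p,q|0,n}$. Then there exists a unique $\mathfrak g_{\bar0}$-constituent $L_0(\Lambda')$ of $L(\Lambda;\Delta^+_{\mathrm{st}})$ satisfying $$-(\Lambda+2\rho^{\mathrm{st}},\Lambda)+(\Lambda'+2\rho^{\mathrm{st}},\Lambda')+2\sum_{i=p+1}^{m}\sum_{a=1}^{n}(\Lambda',\epsilon_i-\delta_a)=0 .$$ For this weight $\Lambda'$, one has $L(\Lambda;\Delta^+_{\mathrm{st}})\cong\Pi^{\epsilon}L(\Lambda';\Delta^+_{\mathrm{nst}})$ for some $\epsilon\in\{0,1\}$.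
   Context: Ground field $\mathbb C$. $\mathfrak g=\mathfrak g_{\bar0}\oplus\mathfrak g_{\bar1}=\mathfrak{sl}(m|n)$ consists of $(m+n)\times(m+n)$ block matrices of supertrace $0$, with even part block diagonal and odd part block off-diagonal; $(X,Y)=\mathrm{str}(XY)$. In the case $m=n$, all weight-theoretic statements (weights, the form on weights, highest weight representations) are understood after passing from $\mathfrak{sl}(n|n)$ to $\mathfrak{gl}(n|n)$. $\mathfrak h$ is the diagonal Cartan subalgebra; $\epsilon_i$ ($1\le i\le m$) and $\delta_a$ ($1\le a\le n$) are the coordinate functions (the $i$-th, resp. $(m+a)$-th, diagonal entry). The form $(\cdot,\cdot)$ on $\mathfrak h^*$ is induced by the supertrace form ($(\epsilon_i,\epsilon_j)=\delta_{ij}$, $(\delta_a,\delta_b)=-\delta_{ab}$, $(\epsilon_i,\delta_a)=0$ on the dual of the full diagonal subalgebra of $\mathfrak{gl}(m|n)$). Positive systems: $\Delta_{\bar0}^+=\{\epsilon_i-\epsilon_j:i<j\}\sqcup\{\delta_a-\delta_b:a<b\}$; $\Delta^+_{\mathrm{st}}=\Delta_{\bar0}^+\sqcup\{\epsilon_i-\delta_a: 1\le i\le m,\ 1\le a\le n\}$; $\Delta^+_{\mathrm{nst}}=\Delta_{\bar0}^+\sqcup\{\epsilon_i-\delta_a:1\le i\le p,\ 1\le a\le n\}\sqcup\{\delta_a-\epsilon_j:p<j\le m,\ 1\le a\le n\}$. For a positive system, $\rho=\rho_{\bar0}-\rho_{\bar1}$ with $\rho_{\bar z}=\frac12\sum_{\alpha\in\Delta^+_{\bar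 z}}\alpha$; $\rho^{\mathrm{st}}$ is the Weyl vector of $\Delta^+_{\mathrm{st}}$. $L(\Lambda;\Delta^+)$ is the simple highest weight $\mathfrak g$-representation of highest weight $\Lambda$ with respect to $\Delta^+$; $\Pi$ denotes parity reversal. $L_0(\mu)$ is the simple highest weight $\mathfrak g_{\bar0}$-module of highest weight $\mu$ with respect to $\Delta_{\bar0}^+$; the restriction of a unitary highest weight representation to $\mathfrak g_{\bar0}$ is a finite direct sum of modules $L_0(\mu)$, its $\mathfrak g_{\bar0}$-constituents. $\omega_{p,q|0,n}(X)=J^{-1}\overline{X}^{\,t}J$ with $J=\mathrm{diag}(I_p,-I_q,-I_n)$. A representation $\mathcal H=\mathcal H_{\bar0}\oplus\mathcal H_{\bar1}$ is unitary if it carries a positive definite Hermitian form with $\langle\mathcal H_{\bar0},\mathcal H_{\bar1}\rangle=0$ and $\langle Xv,w\rangle=\langle v,\omega(X)w\rangle$ for all $X\in\mathfrak g$, $v,w\in\mathcal H$. *)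

(* Defs.v *)
(* The ground field is [R[i]], the complex numbers over [R : realType]. *)
From HB Require Import structures.
From mathcomp Require Import all_boot all_order all_algebra.
From mathcomp Require Import complex.
From mathcomp Require Import boolp classical_sets reals.

Set Implicit Arguments.
Unset Strict Implicit.
Unset Printing Implicit Defensive.

Import Order.TTheory GRing.Theory Num.Theory.
Local Open Scope complex_scope.
Local Open Scope classical_set_scope.
Local Open Scope ring_scope.

Section LieSuperalgebra.
Variables (R : realType) (m n : nat).
Local Notation C := R[i].
Local Notation Mat := 'M[C]_(m + n).

Definition supertrace (X : Mat) : C :=
  \tr (ulsubmx X) - \tr (drsubmx X).

Lemma supertraceE (X : Mat) :
  supertrace X = \sum_(k < m + n) (-1) ^+ (m <= k)%N * X k k.
Proof.
rewrite big_split_ord /supertrace /mxtrace -sumrN; congr (_ + _).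
  by apply: eq_bigr => i _; rewrite !mxE /= leqNgt ltn_ord mul1r.
by apply: eq_bigr => i _; rewrite !mxE /= leq_addr mulN1r.
Qed.

Lemma supertrace_is_linear : linear (supertrace : Mat -> C^o).
Proof.
move=> a X Y; rewrite !supertraceE scaler_sumr -big_split /=.
apply: eq_bigr => k _; rewrite !mxE mulrDr /GRing.scale /=.
by rewrite mulrCA.
Qed.
HB.instance Definition _ :=
  GRing.isLinear.Build C Mat C^o _ (supertrace : Mat -> C^o)
    supertrace_is_linear.

Definition strform (X Y : Mat) : C := supertrace (X *m Y).

(* [homog false] is the block diagonal (even) part, [homog true] the block
   off-diagonal (odd) part. *)
Definition homog (z : bool) (X : Mat) : Prop :=
  if z then ulsubmx X = 0 /\ drsubmx X = 0
  else ursubmx X = 0 /\ dlsubmx X = 0.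

(* Bracket of homogeneous elements of parities [z] and [w]. *)
Definition sbracket (z w : bool) (X Y : Mat) : Mat :=
  X *m Y - (-1) ^+ (z && w) *: (Y *m X).

Definition sl : {vspace Mat} :=
  lker (linfun (supertrace : Mat -> C^o)).

Lemma mem_sl X : (X \in sl) = (supertrace X == 0).
Proof. by rewrite memv_ker lfunE. Qed.

(* The algebra whose highest weight representations are considered: sl(m|n),
   replaced by gl(n|n) when m = n.  Weights are accordingly functionals on the
   diagonal matrices of supertrace 0 when m != n, and on all diagonal matrices
   when m = n. *)
Definition galg : {vspace Mat} := if m == n then fullv else sl.

Definition cartan : {vspace Mat} :=
  (galg :&: limg (linfun (@diag_mx C (m + n))))%VS.

Lemma mem_cartan X : (X \in cartan) = is_diag_mx X && (X \in galg).
Proof.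
rewrite memv_cap andbC; congr (_ && _); apply/memv_imgP/diag_mxP => [|].
  by move=> [d _ ->]; exists d; rewrite lfunE.
by move=> [d ->]; exists d; rewrite ?memvf ?lfunE.
Qed.

Definition weight := 'Hom(subvs_of cartan, C^o).

Definition coord_fun (k : 'I_(m + n)) (H : subvs_of cartan) : C^o :=
  vsval H k k.

Lemma coord_fun_is_linear k : linear (coord_fun k).
Proof. by move=> a X Y; rewrite /coord_fun linearP !mxE. Qed.
HB.instance Definition _ k :=
  GRing.isLinear.Build C (subvs_of cartan) C^o _ (coord_fun k)
    (coord_fun_is_linear k).

Definition coordw (k : 'I_(m + n)) : weight := linfun (coord_fun k).

Definition epsilon (i : 'I_m) : weight := coordw (lshift n i).
Definition delta (a : 'I_n) : weight := coordw (rshift m a).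

Lemma coordwE k H : coordw k H = vsval H k k.
Proof. by rewrite lfunE. Qed.

(* The form on h^* induced by the supertrace form on h: [tvec lam] is the
   unique element of h representing [lam], see [tvecP] and [tvec_unique]. *)
Definition tvec (lam : weight) : subvs_of cartan :=
  xget 0 [set T | forall H, lam H = strform (vsval T) (vsval H)].

Lemma strform_diag (d : 'rV[C]_(m + n)) (X : Mat) :
  strform (diag_mx d) X = \sum_(k < m + n) (-1) ^+ (m <= k)%N * (d 0 k * X k k).
Proof.
rewrite /strform supertraceE; apply: eq_bigr => k _; congr (_ * _).
by rewrite mul_diag_mx mxE.
Qed.

(* Projection of the diagonal matrices onto h along the scalar matrices when
   m != n. *)
Let pr (d : 'rV[C]_(m + n)) : Mat :=
  diag_mx d
  - (if m == n then 0 else supertrace (diag_mx d) / (m%:R - n%:R))%:M.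

Let str1 a : supertrace a%:M = (m%:R - n%:R) * a.
Proof.
rewrite supertraceE big_split_ord mulrBl !mulr_natl -[in RHS](card_ord m) -[in RHS](card_ord n).
rewrite -!sumr_const -sumrN; congr (_ + _); apply: eq_bigr => i _.
  by rewrite mxE eqxx /= leqNgt ltn_ord mul1r.
by rewrite mxE eqxx /= leq_addr mulN1r.
Qed.

Let mn_neq0 : m != n -> (m%:R - n%:R : C) != 0.
Proof. by rewrite subr_eq0 eqr_nat. Qed.

Let pr_cartan d : pr d \in cartan.
Proof.
rewrite mem_cartan; apply/andP; split.
  by rewrite /pr -diag_const_mx -linearB /= diag_mx_is_diag.
rewrite /galg; case: ifPn => [_|mn]; first exact: memvf.
rewrite mem_sl /pr (negPf mn) (raddfB (supertrace : Mat -> C^o)) /= str1.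
by rewrite mulrCA mulfV ?mn_neq0 // mulr1 subrr.
Qed.

Let str_pr d H : H \in cartan ->
  strform (pr d) H = \sum_(k < m + n) (-1) ^+ (m <= k)%N * (d 0 k * H k k).
Proof.
rewrite mem_cartan => /andP[_ gH]; rewrite -strform_diag /pr /strform mulmxBl.
rewrite (raddfB (supertrace : Mat -> C^o)) /= mul_scalar_mx.
rewrite (linearZ_LR (supertrace : Mat -> C^o)) /=.
case: ifPn => mn; first by rewrite scale0r subr0.
move: gH; rewrite /galg (negPf mn) mem_sl => /eqP ->.
by rewrite scaler0 subr0.
Qed.

Let cartanP (H : subvs_of cartan) : exists d, vsval H = diag_mx d.
Proof.
by have := subvsP H; rewrite mem_cartan => /andP[/diag_mxP].
Qed.

Let strformC (T H : subvs_of cartan) :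
  strform (vsval T) (vsval H) = strform (vsval H) (vsval T).
Proof.
have [t ->] := cartanP T; have [h ->] := cartanP H.
rewrite !strform_diag; apply: eq_bigr => k _.
by rewrite !mxE eqxx !mulr1n [t _ _ * _]mulrC.
Qed.

Let prv d : subvs_of cartan := Subvs (pr_cartan d).

Let str_prv d (H : subvs_of cartan) : strform (vsval (prv d)) (vsval H)
  = \sum_(k < m + n) (-1) ^+ (m <= k)%N * (d 0 k * vsval H k k).
Proof. exact/str_pr/subvsP. Qed.

Let str_prvk k (H : subvs_of cartan) :
  strform (vsval (prv (delta_mx 0 k))) (vsval H)
  = (-1) ^+ (m <= k)%N * vsval H k k.
Proof.
rewrite str_prv (bigD1 k) //= big1 => [|i ik].
  by rewrite addr0 [delta_mx _ _ _ _]mxE !eqxx mul1r.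
by rewrite [delta_mx _ _ _ _]mxE (negPf ik) andbF mul0r mulr0.
Qed.

Lemma tvec_unique (T T' : subvs_of cartan) :
  (forall H : subvs_of cartan,
     strform (vsval T) (vsval H) = strform (vsval T') (vsval H)) -> T = T'.
Proof.
move=> eqT; have eqkk k : vsval T k k = vsval T' k k.
  have := eqT (prv (delta_mx 0 k)).
  rewrite strformC [RHS]strformC !str_prvk => /mulfI; apply.
  by rewrite signr_eq0.
apply: val_inj; apply/matrixP => k l /=.
have [t tE] := cartanP T; have [t' t'E] := cartanP T'.
have [<-//|kl] := eqVneq k l.
rewrite tE t'E [LHS]mxE [RHS]mxE (negPf kl).
by [].
Qed.

Let sum_prv (H : subvs_of cartan) :
  H = \sum_(k < m + n) vsval H k k *: prv (delta_mx 0 k).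
Proof.
apply: tvec_unique => K; have [d dE] := cartanP H.
rewrite [X in strform X]dE strform_diag /strform.
rewrite [vsval (\sum_(_ < _) _)]linear_sum /= mulmx_suml.
rewrite (raddf_sum (supertrace : Mat -> C^o)) /=.
apply: eq_bigr => k _.
rewrite -scalemxAl (linearZ_LR (supertrace : Mat -> C^o)) /=.
have := str_prvk k K; rewrite /strform => ->.
rewrite dE [diag_mx d k k]mxE eqxx mulr1n.
by rewrite /GRing.scale /= mulrCA.
Qed.

Lemma tvecP (lam : weight) (H : subvs_of cartan) :
  lam H = strform (vsval (tvec lam)) (vsval H).
Proof.
pose mu := \row_k ((-1) ^+ (m <= k)%N * lam (prv (delta_mx 0 k))).
suff : [set T | forall H, lam H = strform (vsval T) (vsval H)] (tvec lam).
  exact.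
apply: (@xgetPex _ 0); exists (prv mu) => /= {}H.
rewrite str_prv {1}[H]sum_prv linear_sum; apply: eq_bigr => k _.
by rewrite linearZ /= [mu _ _]mxE !mulrA -signr_addb addbb mul1r mulrC.
Qed.

Definition wform (lam mu : weight) : C :=
  strform (vsval (tvec lam)) (vsval (tvec mu)).

Lemma wform_coordw (k l : 'I_(m + n)) : m = n ->
  wform (coordw k) (coordw l) = (-1) ^+ (m <= k)%N * (k == l)%:R.
Proof.
move=> mn; rewrite /wform -tvecP coordwE.
have := tvecP (coordw l) (prv (delta_mx 0 k)).
rewrite strformC str_prvk coordwE => /(congr1 ( *%R ((-1) ^+ (m <= k)%N))).
rewrite mulrA -signr_addb addbb mul1r => <-.
rewrite [vsval _]/= /pr; have -> : m == n by apply/eqP.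
rewrite (raddf0 (@scalar_mx C (m + n))) subr0 !mxE !eqxx /=.
by rewrite [l == k]eq_sym; case: (k == l); rewrite ?mulr0.
Qed.

(* Write x_k for the k-th of the coordinate functions
   epsilon_1, ..., epsilon_m, delta_1, ..., delta_n.  The roots are the
   x_k - x_l with k != l, they are pairwise distinct on h, and the root space
   of x_k - x_l is spanned by the matrix unit [delta_mx k l].  A positive system
   is given as the relation "x_k - x_l is a positive root". *)
Definition rootw (k l : 'I_(m + n)) : weight := coordw k - coordw l.

Definition odd_root (k l : 'I_(m + n)) : bool := (k < m)%N (+) (l < m)%N.

Definition pos_even : rel 'I_(m + n) := fun k l =>
  match fintype.split k, fintype.split l with
  | inl i, inl j => (i < j)%N
  | inr a, inr b => (a < b)%N
  | _, _ => false
  end.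

Definition pos_st : rel 'I_(m + n) := fun k l =>
  pos_even k l ||
  match fintype.split k, fintype.split l with
  | inl _, inr _ => true
  | _, _ => false
  end.

(* Indices start at 0, so the first [p] of the epsilons are those with
   [i < p]. *)
Definition pos_nst (p : nat) : rel 'I_(m + n) := fun k l =>
  pos_even k l ||
  match fintype.split k, fintype.split l with
  | inl i, inr _ => (i < p)%N
  | inr _, inl j => (p <= j)%N
  | _, _ => false
  end.

Definition rho_part (pos : rel 'I_(m + n)) (z : bool) : weight :=
  2%:R^-1 *: \sum_k \sum_(l | pos k l && (odd_root k l == z)) rootw k l.

Definition rho (pos : rel 'I_(m + n)) : weight :=
  rho_part pos false - rho_part pos true.

Definition is_subspace (V : lmodType C) (W : set V) : Prop :=
  W 0 /\ forall (a : C) u v, W u -> W v -> W (a *: u + v).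

(* Representations of the Lie superalgebra [galg].  [part z] is the homogeneous
   component of parity [z]; [act X] is meaningful only for X in [galg]. *)
Record srep := SRep {
  space :> lmodType C;
  part : bool -> set space;
  act : Mat -> space -> space;
  part_subspace : forall z, is_subspace (part z);
  part_span : forall v,
    exists v0 v1, [/\ part false v0, part true v1 & v = v0 + v1];
  part_direct : forall v, part false v -> part true v -> v = 0;
  act_linearl : forall (a : C) X Y v, X \in galg -> Y \in galg ->
    act (a *: X + Y) v = a *: act X v + act Y v;
  act_linearr : forall X (a : C) u v, X \in galg ->
    act X (a *: u + v) = a *: act X u + act X v;
  act_part : forall z w X v, X \in galg -> homog z X -> part w v ->
    part (z (+) w) (act X v);
  act_bracket : forall z w X Y v,
    X \in galg -> Y \in galg -> homog z X -> homog w Y ->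
    act (sbracket z w X Y) v
    = act X (act Y v) - (-1) ^+ (z && w) *: act Y (act X v)
}.

Section ParityReversal.
Variable H : srep.

Let Ppart_span (v : H) : exists v0 v1 : H,
  [/\ part true v0, part false v1 & v = v0 + v1].
Proof.
have [v0 [v1 [h0 h1 ->]]] := part_span v.
by exists v1, v0; split; rewrite // addrC.
Qed.

Let Ppart_direct (v : H) : part true v -> part false v -> v = 0.
Proof. by move=> h1 h0; exact: part_direct. Qed.

Let Pact_part z w X (v : H) : X \in galg -> homog z X ->
  part (~~ w) v -> part (~~ (z (+) w)) (act X v).
Proof.
move=> gX zX wv; have -> : ~~ (z (+) w) = z (+) ~~ w by case: z {zX}; case: w {wv}.
exact: act_part.
Qed.

Definition parity_rev : srep :=
  @SRep H (fun z => part (~~ z)) (@act H)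
    (fun z => part_subspace H (~~ z)) Ppart_span Ppart_direct
    (@act_linearl H) (@act_linearr H) Pact_part (@act_bracket H).

End ParityReversal.

Definition parity_pow (e : bool) (H : srep) : srep :=
  if e then parity_rev H else H.

Definition srep_iso (H K : srep) : Prop :=
  exists f : {linear H -> K}, [/\ bijective f,
    forall z v, part z v -> part z (f v)
  & forall X v, X \in galg -> f (act X v) = act X (f v)].

Definition subrep (H : srep) (W : set H) : Prop :=
  [/\ is_subspace W,
      forall v0 v1, part false v0 -> part true v1 -> W (v0 + v1) ->
        W v0 /\ W v1
    & forall X v, X \in galg -> W v -> W (act X v)].

Definition simple_rep (H : srep) : Prop :=
  (exists v : H, v != 0) /\
  forall W : set H, subrep W -> W = [set 0] \/ W = setT.

Definition highest_weight_vector (H : srep) (pos : rel 'I_(m + n))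
    (lam : weight) (v : H) : Prop :=
  [/\ v != 0,
      forall T : subvs_of cartan, act (vsval T) v = lam T *: v
    & forall k l, pos k l -> act (delta_mx k l) v = 0].

(* [H] is a model of L(lam; pos), which is defined up to (even) isomorphism;
   the highest weight vector is taken even. *)
Definition is_simple_hw (H : srep) (pos : rel 'I_(m + n)) (lam : weight)
    : Prop :=
  simple_rep H /\
  exists v : H, part false v /\ highest_weight_vector pos lam v.

(* Subspaces stable under the even part of [galg]. *)
Definition even_subrep (H : srep) (W : set H) : Prop :=
  is_subspace W /\
  forall X v, X \in galg -> homog false X -> W v -> W (act X v).

(* [W] is a submodule of the restriction of [H] to the even part of [galg]
   which is isomorphic to L_0(mu): simple, with highest weight mu. *)
Definition even_constituent (H : srep) (W : set H) (mu : weight) : Prop :=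
  [/\ even_subrep W,
      forall W' : set H, even_subrep W' -> W' `<=` W ->
        W' = [set 0] \/ W' = W
    & exists v, W v /\ highest_weight_vector pos_even mu v].

End LieSuperalgebra.

Section Unitary.
Variables (R : realType) (p q n : nat).
Local Notation C := R[i].

Definition Jmx : 'M[C]_(p + q + n) :=
  block_mx (block_mx 1%:M 0 0 (- 1%:M)) 0 0 (- 1%:M).

Definition omega (X : 'M[C]_(p + q + n)) : 'M[C]_(p + q + n) :=
  invmx Jmx *m (map_mx Num.conj X)^T *m Jmx.

(* Also for p + q = n invariance of the form is only required under
   sl(n|n). *)
Definition unitary (H : srep R (p + q) n) : Prop :=
  exists form : {dot H for (@Num.conj C)},
    (forall v w, part false v -> part true w -> form v w = 0) /\
    (forall X v w, X \in sl R (p + q) n ->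
       form (act X v) w = form v (act (omega X) w)).

End Unitary.

Arguments epsilon {R m n} i.
Arguments delta {R m n} a.
Arguments rho {R m n} pos.
Arguments pos_even {m n}.
Arguments pos_st {m n}.
Arguments pos_nst {m n} p.

(* Main.v *)
From HB Require Import structures.
Require Import Defs.
From mathcomp Require Import all_boot all_order all_algebra.
From mathcomp Require Import perm zify ring.
From mathcomp Require Import complex.
From mathcomp Require Import boolp classical_sets reals.

(* By unitarity, a vector killed by all positive even root vectors and of weight
   mu satisfies
     (-(Lambda + 2 rho, Lambda) + (mu + 2 rho, mu) + 2 sum (mu, eps_i - delta_a)) |v|^2
       = 2 sum |E_alpha v|^2,
   where alpha runs over the odd roots of the nonstandard system: the left-hand
   side compares the values of the Casimir element of gl(m|n) on L and on v.
   So the highest weight vectors of the required constituents are exactly the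
   highest weight vectors of L for the nonstandard system.  One is produced from
   that of the standard system by a chain of odd reflections.  It is unique up to
   a scalar since, for the invariant form, every such vector is orthogonal to the
   image of each negative root vector.  The isomorphism with a given model of
   L(Lambda'; nst) is the submodule of the direct sum generated by the pair of
   highest weight vectors, which is the graph of a bijection. *)

Set Implicit Arguments.
Unset Strict Implicit.
Unset Printing Implicit Defensive.

Import Order.TTheory GRing.Theory Num.Theory.
Local Open Scope ring_scope.

(** The Casimir element belongs to gl(m|n), while the given representation is one of sl(m|n) when m
    != n. Letting the scalar matrices act by zero extends it to gl(m|n); the Casimir values are
    still those of the form on h, because the elements of h that represent weights have supertrace
    0. L is infinite-dimensional in general, and no weight decomposition is set up. Its role is
    played by one diagonal operator with natural coefficients, increasing along the order of the
    coordinates: every lowering operator raises its eigenvalue, so a polynomial in it isolates the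
    highest weight vector inside any submodule. The extra sum in the equation comes from exchanging,
    for i > p, the raising operators of the roots eps_i - delta_a for those of delta_a - eps_i. With
    the signs of J, exactly the resulting products become norms of one and the same sign, so that
    the vanishing of their sum forces each of them to vanish. *)

Definition full_rel {N} : rel 'I_N := fun _ _ => true.

Lemma full_rel_sym N : symmetric (@full_rel N). Proof. by []. Qed.

Lemma full_rel_trans N : transitive (@full_rel N). Proof. by []. Qed.

(** * Modules over gl(m|n) *)

Section GlModule.
Variables (F : numFieldType) (N : nat) (par : 'I_N -> bool).

Definition ksign (a b k l : 'I_N) : F :=
  (-1) ^+ ((par a (+) par b) && (par k (+) par l)).

Definition psign k : F := (-1) ^+ par k.

Lemma psignM k l : psign k * psign l = (-1) ^+ (par k (+) par l).
Proof. by rewrite -signr_addb. Qed.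

Lemma psign_sqr k : psign k ^+ 2 = 1.
Proof. exact: sqrr_sign. Qed.

Lemma psignMr k l : psign l * (-1) ^+ (par k (+) par l) = psign k.
Proof. by rewrite -signr_addb addbC addbK. Qed.

(* [e k l] stands for the action of the matrix unit E_kl of parity [par k + par l]. *)
Definition gl_module (V : lmodType F) (e : 'I_N -> 'I_N -> {linear V -> V}) :=
  forall a b k l v, e a b (e k l v) = ksign a b k l *: e k l (e a b v)
    + (b == k)%:R *: e a l v - (ksign a b k l * (l == a)%:R) *: e k b v.

Section Operators.
Variables (V : lmodType F) (e : 'I_N -> 'I_N -> {linear V -> V}).
Hypothesis eC : gl_module e.

Lemma ksign_diag k a b : ksign k k a b = 1.
Proof. by rewrite /ksign addbb. Qed.

Lemma e_diagC k a b v :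
  e k k (e a b v) = e a b (e k k v) + ((k == a)%:R - (b == k)%:R) *: e a b v.
Proof.
rewrite eC ksign_diag scale1r mul1r scalerBl addrA.
congr (_ + _ - _); first by case: eqVneq => [->|_] //; rewrite !scale0r.
by case: eqVneq => [->|_] //; rewrite !scale0r.
Qed.

(** The superbracket of an odd E_ab with itself is 2 E_ab^2, and it is zero because a != b; the
    characteristic is 0. *)
Lemma odd_square a b v : par a != par b -> e a b (e a b v) = 0.
Proof.
move=> ab; have {}ab : par a (+) par b by rewrite addbC; case: (par a) (par b) ab => -[].
have nab : a != b by apply: contraTneq ab => ->; rewrite addbb.
have := eC a b a b v; rewrite /ksign ab (negPf (_ : b != a)) 1?eq_sym//=.
rewrite mulr0 !scale0r subr0 addr0 scaleN1r => /eqP.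
rewrite -addr_eq0 -mulr2n -scaler_nat scaler_eq0 pnatr_eq0 /=.
by move/eqP.
Qed.

Definition weight_vector (lam : 'I_N -> F) v := forall k, e k k v = lam k *: v.

Lemma weight_vector_act lam v a b : weight_vector lam v ->
  weight_vector (fun k => lam k + (k == a)%:R - (b == k)%:R) (e a b v).
Proof.
by move=> wv k; rewrite e_diagC wv linearZZ -scalerDl addrA.
Qed.

(** * Cyclic submodules generated by a highest weight vector *)

Section Lowering.
Variables (a : rel 'I_N) (r : 'I_N -> nat).
Hypotheses (a_sym : symmetric a) (a_trans : transitive a) (r_inj : injective r).

(** [a] selects the subalgebra spanned by the E_kl with [a k l] (everything for [full_rel], the even
    part for [same_parity]), and the rank [r] a positive system in it. One development thus serves
    standard, nonstandard and even highest weights. *)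
Definition below k l := a k l && (r k < r l)%N.

Definition raised_to_0 v := forall k l, below k l -> e k l v = 0.

(* The span of the products of lowering operators applied to [v]; for [gen_pos],
   of the nonempty products. *)
Inductive gen (v : V) : V -> Prop :=
| gen_hw : gen v v
| gen_lin c u w : gen v u -> gen v w -> gen v (c *: u + w)
| gen_low k l u : below k l -> gen v u -> gen v (e l k u).

Inductive gen_pos (v : V) : V -> Prop :=
| gen_pos0 : gen_pos v 0
| gen_pos_lin c u w : gen_pos v u -> gen_pos v w -> gen_pos v (c *: u + w)
| gen_pos_low k l u : below k l -> gen v u -> gen_pos v (e l k u).

Lemma gen0 v : gen v 0.
Proof. by rewrite -(addNr v) -scaleN1r; do 2![constructor]. Qed.

Lemma genZ v c u : gen v u -> gen v (c *: u).
Proof. by move=> gu; rewrite -[_ *: _]addr0; apply: gen_lin => //; apply: gen0. Qed.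

Lemma genD v u w : gen v u -> gen v w -> gen v (u + w).
Proof. by move=> gu gw; rewrite -[u]scale1r; apply: gen_lin. Qed.

Lemma genB v u w : gen v u -> gen v w -> gen v (u - w).
Proof. by move=> gu gw; rewrite addrC -scaleN1r; apply: gen_lin. Qed.

Lemma gen_split v u : gen v u -> exists c w, gen_pos v w /\ u = c *: v + w.
Proof.
elim=> [|c _ _ _ [c1 [w1 [g1 ->]]] _ [c2 [w2 [g2 ->]]]|k l {}u kl gu _].
- by exists 1, 0; rewrite scale1r addr0; split=> //; constructor.
- exists (c * c1 + c2), (c *: w1 + w2); split; first by constructor.
  by rewrite scalerDr scalerA addrACA -scalerDl.
- by exists 0, (e l k u); rewrite scale0r add0r; split=> //; constructor.
Qed.

Section HighestWeight.
Variables (lam : 'I_N -> F) (v : V).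
Hypotheses (wv : weight_vector lam v) (rv : raised_to_0 v).

(** Induction on the generation of [u], for all units of the subalgebra at once: moving E_kl past a
    lowering operator costs commutators which are again units of the subalgebra, applied to a vector
    generated earlier. *)
Lemma gen_stable k l u : a k l -> gen v u -> gen v (e k l u).
Proof.
move=> akl gu; elim: gu k l akl => [|c u1 u2 _ IH1 _ IH2|i j u1 ij gu1 IH] k l akl.
- have [rkl|rkl|/r_inj ->] := ltngtP (r k) (r l).
  + by rewrite rv ?/below ?akl//; apply: gen0.
  + by apply: gen_low; [rewrite /below a_sym akl|constructor].
  + by rewrite wv; apply: genZ; constructor.
- by rewrite linearP; apply: gen_lin; [exact: IH1|exact: IH2].
- have aij : a i j by case/andP: ij.
  rewrite eC; apply: genB; first apply: genD.
  + by apply: genZ; apply: gen_low => //; apply: IH.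
  + have [lj|_] := eqVneq l j; last by rewrite scale0r; apply: gen0.
    by apply: genZ; apply: IH; apply: a_trans akl _; rewrite lj a_sym.
  + have [ik|_] := eqVneq i k; last by rewrite mulr0 scale0r; apply: gen0.
    by apply: genZ; apply: IH; apply: a_trans akl; rewrite -ik a_sym.
Qed.

(* [ht] separates [v] from the rest of the module: it acts on a product of
   lowering operators applied to [v] by a scalar larger than its scalar on [v]. *)
Definition ht (u : V) : V := \sum_k (r k)%:R *: e k k u.
Let h0 := \sum_k (r k)%:R * lam k.
(** [h0] is the eigenvalue of [ht] on [v], so this kills the vectors lying exactly [d] steps of
    height away from [v]. *)
Definition ht_shift (d : nat) u := ht u - (h0 + d%:R) *: u.
Definition ht_prod (s : seq nat) u := foldr ht_shift u s.

Lemma ht_linear : linear ht.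
Proof.
move=> c x y; rewrite /ht scaler_sumr -big_split; apply: eq_bigr => k _ /=.
by rewrite linearP scalerDr !scalerA mulrC.
Qed.

Lemma ht_shift_linear d : linear (ht_shift d).
Proof.
move=> c x y; rewrite /ht_shift ht_linear scalerBr scalerDr !scalerA.
by rewrite opprD addrACA [_ * c]mulrC.
Qed.

Lemma ht_prod_linear s : linear (ht_prod s).
Proof.
by elim: s => [|d s IH] c x y //=; rewrite IH ht_shift_linear.
Qed.

Lemma ht_prod0 s : ht_prod s 0 = 0.
Proof. by have := ht_prod_linear s (-1) 0 0; rewrite !scaleN1r !addNr. Qed.

Lemma ht_shiftC d d' u : ht_shift d (ht_shift d' u) = ht_shift d' (ht_shift d u).
Proof.
have htB x c y : ht (x - c *: y) = ht x - c *: ht y.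
  by have := ht_linear (- c) y x; rewrite !scaleNr [- _ + x]addrC [- _ + ht x]addrC.
rewrite /ht_shift !htB !scalerBr !scalerA !opprB.
rewrite !addrA [(_ + d'%:R) * _]mulrC -!addrA; congr (_ + _).
by rewrite addrCA [RHS]addrCA; congr (_ + _); rewrite addrC.
Qed.

Lemma ht_prod_cat s t u : ht_prod (s ++ t) u = ht_prod s (ht_prod t u).
Proof. by rewrite /ht_prod foldr_cat. Qed.

Lemma ht_prodC s t u : ht_prod s (ht_prod t u) = ht_prod t (ht_prod s u).
Proof.
have sC d x : ht_shift d (ht_prod s x) = ht_prod s (ht_shift d x).
  by elim: s x => //= d' s' IH x; rewrite ht_shiftC IH.
by elim: t => //= d t IH; rewrite -sC IH.
Qed.

Lemma ht_low k l u : ht (e l k u) = e l k (ht u) + ((r l)%:R - (r k)%:R) *: e l k u.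
Proof.
rewrite /ht linear_sum /= (eq_bigr (fun i => e l k ((r i)%:R *: e i i u)
   + ((r i)%:R * ((i == l)%:R - (k == i)%:R)) *: e l k u)); last first.
  by move=> i _; rewrite e_diagC scalerDr (linearZZ (e l k)) scalerA.
rewrite big_split -scaler_suml; congr (_ + _ *: _).
under eq_bigr do rewrite mulrBr.
rewrite sumrB (bigD1 l) //= eqxx mulr1 big1 => [|i /negPf->]; last by rewrite mulr0.
rewrite [in X in _ - X](bigD1 k) //= eqxx mulr1 [in X in _ - (_ + X)]big1 ?addr0//.
by move=> i; rewrite eq_sym => /negPf->; rewrite mulr0.
Qed.

(** E_lk adds r l - r k to the eigenvalue of [ht], so passing it translates every parameter by that
    amount; the natural subtraction is exact by [below k l]. *)
Lemma ht_prod_low k l s u : below k l ->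
  ht_prod (map (addn (r l - r k)) s) (e l k u) = e l k (ht_prod s u).
Proof.
case/andP=> _ kl; elim: s => [//|d s IH].
rewrite map_cons [LHS]/= IH [in RHS]/=; set x := ht_prod s u.
rewrite /ht_shift ht_low natrD natrB 1?ltnW//.
rewrite [in RHS]linearB /= [in RHS]linearZ_LR -addrA; congr (_ + _).
rewrite -[- (_ *: e l k x)]scaleNr -scalerDl -[RHS]scaleNr; congr (_ *: _).
by rewrite opprD addrCA opprD addNKr -opprD.
Qed.

Lemma ht_shift_hw d : ht_shift d v = - d%:R *: v.
Proof.
rewrite /ht_shift /ht (eq_bigr (fun k => ((r k)%:R * lam k) *: v)).
  by rewrite -scaler_suml -scalerBl opprD addNKr.
by move=> k _; rewrite wv scalerA.
Qed.

(** The parameter 0 kills [v]; sums are handled by concatenation, since the shifts commute, and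
    lowering by translating the parameters. *)
Lemma gen_ann u : gen v u -> exists s, ht_prod s u = 0.
Proof.
elim=> [|c x y _ [s sx] _ [t ty]|k l x kl _ [s sx]].
- by exists [:: 0%N]; rewrite [LHS]ht_shift_hw oppr0 scale0r.
- exists (s ++ t); rewrite ht_prod_cat !ht_prod_linear ty ht_prod0 addr0 -[RHS](scaler0 _ c).
  by rewrite ht_prodC sx ht_prod0.
- by exists (map (addn (r l - r k)) s); rewrite ht_prod_low // sx linear0.
Qed.

(** The outermost lowering operator translates all parameters by at least 1. None of the factors
    then kills [v], on which the shift by d is multiplication by -d. *)
Lemma gen_pos_ann u : gen_pos v u -> exists2 s, all (leq 1) s & ht_prod s u = 0.
Proof.
elim=> [|c x y _ [s sp sx] _ [t tp ty]|k l x kl gx].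
- by exists [::].
- exists (s ++ t); first by rewrite all_cat sp.
  rewrite ht_prod_cat !ht_prod_linear ty ht_prod0 addr0 -[RHS](scaler0 _ c).
  by rewrite ht_prodC sx ht_prod0.
- have [s sx] := gen_ann gx; exists (map (addn (r l - r k)) s).
    case/andP: kl => _; rewrite -subn_gt0 => kl; apply/allP => _ /mapP[d _ ->].
    exact: leq_trans kl (leq_addr _ _).
  by rewrite ht_prod_low // sx linear0.
Qed.

Lemma ht_prod_hw s : ht_prod s v = (\prod_(d <- s) - d%:R) *: v.
Proof.
elim: s => [|d s IH]; first by rewrite big_nil scale1r.
rewrite /= IH -[_ *: v]addr0 ht_shift_linear big_cons.
rewrite ht_shift_hw.
have -> : ht_shift d 0 = 0 by apply: (ht_prod0 [:: d]).
by rewrite addr0 scalerA mulrC.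
Qed.

(* A product of shifts of [ht] kills [w] and acts on [v] by a nonzero scalar. *)
Lemma gen_extract (W : V -> Prop) c w :
    W 0 -> (forall x u1 u2, W u1 -> W u2 -> W (x *: u1 + u2)) ->
    (forall k u, W u -> W (e k k u)) ->
  gen_pos v w -> W (c *: v + w) -> W (c *: v).
Proof.
move=> W0 Wlin We gw Wu.
have WZ x u : W u -> W (x *: u) by move=> Wx; rewrite -[_ *: u]addr0; apply: Wlin.
have Wht u : W u -> W (ht u).
  move=> Wu'; rewrite /ht; elim/big_rec: _ => [|k x _ Wx] //; apply: Wlin => //.
  exact: We.
have Wshift d u : W u -> W (ht_shift d u).
  by move=> Wu'; rewrite /ht_shift addrC -scaleNr; apply: Wlin => //; apply: Wht.
have Wprod s u : W u -> W (ht_prod s u) by elim: s => //= d s IH /IH /Wshift.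
have [s sp sw] := gen_pos_ann gw.
have := Wprod s _ Wu; rewrite ht_prod_linear sw addr0 ht_prod_hw scalerA mulrC.
move/(WZ (\prod_(d <- s) - d%:R)^-1); rewrite scalerA mulKf //.
elim: s sp {sw} => [|d s IH] /=; first by rewrite big_nil oner_eq0.
case/andP=> dp /IH; rewrite big_cons mulf_eq0 negb_or => ->; rewrite andbT.
by rewrite oppr_eq0 pnatr_eq0 -lt0n.
Qed.

(** Extraction from the zero subspace. *)
Lemma gen_pos_indep c w : v != 0 -> gen_pos v w -> c *: v + w = 0 -> c = 0.
Proof.
move=> v0 gw cvw; apply/eqP; suff: c *: v = 0.
  by move/eqP; rewrite scaler_eq0 (negPf v0) orbF.
apply: (gen_extract (W := fun u => u = 0) _ _ _ gw cvw) => //.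
  by move=> x _ _ -> ->; rewrite scaler0 addr0.
by move=> k _ ->; rewrite linear0.
Qed.

(** The grading [P] is abstract because it is used both for a representation and for a product of
    two, where one factor carries a shifted grading. *)
Lemma gen_graded (P : bool -> V -> Prop) z u :
    (forall y, P y 0) ->
    (forall y c u1 u2, P y u1 -> P y u2 -> P y (c *: u1 + u2)) ->
    (forall y k l w, P y w -> P (par k (+) par l (+) y) (e k l w)) ->
    P z v -> gen v u ->
  exists2 f : bool -> V, (forall y, gen v (f y) /\ P y (f y))
    & u = f false + f true.
Proof.
move=> P0 Plin Pe Pv; elim=> [|c x y _ [f Pf ->] _ [g Pg ->]|k l x kl _ [f Pf ->]].
- exists (fun y => if y == z then v else 0); last by case: z {Pv}; rewrite /= ?add0r ?addr0.
  by move=> y; case: eqP => [->|_]; split=> //; [constructor|exact: gen0].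
- exists (fun y => c *: f y + g y); last by rewrite scalerDr addrACA.
  by move=> y'; have [? ?] := Pf y'; have [? ?] := Pg y'; split; [apply: gen_lin|apply: Plin].
- exists (fun y => e l k (f (par l (+) par k (+) y))).
    move=> y; have [gf Py] := Pf (par l (+) par k (+) y); split; first exact: gen_low.
    by have := Pe _ l k _ Py; rewrite addKb.
  rewrite linearD; case: (par l (+) par k) => //=.
  by rewrite addrC.
Qed.

End HighestWeight.

(** * Consequences of an invariant definite form, seen as an orthogonality relation *)

Section Orthogonality.
Variable orth : V -> V -> Prop.
Hypotheses (orth0 : forall x, orth 0 x)
  (orth_lin : forall c u w x, orth u x -> orth w x -> orth (c *: u + w) x)
  (orthC : forall u w, orth u w -> orth w u)
  (orth_def : forall u, orth u u -> u = 0)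
  (orth_adj : forall k l u w, k != l -> orth u (e l k w) -> orth (e k l u) w).

Lemma below_neq k l : below k l -> k != l.
Proof. by case/andP=> _; apply: contraTneq => ->; rewrite ltnn. Qed.

Lemma gen_pos_orth v x w : raised_to_0 x -> gen_pos v w -> orth w x.
Proof.
move=> rx; elim=> [|c u1 u2 _ ? _ ?|k l u kl _]; [exact: orth0|exact: orth_lin|].
apply: orth_adj; first by rewrite eq_sym below_neq.
by rewrite rx //; apply/orthC/orth0.
Qed.

(** Write x = c v + w with w in [gen_pos v]. Then w is orthogonal to both v and x, hence to
    itself. *)
Lemma raised_unique v x : raised_to_0 v -> raised_to_0 x -> gen v x ->
  exists c, x = c *: v.
Proof.
move=> rv rx /gen_split[c [w [gw xE]]]; exists c; rewrite xE.
suff -> : w = 0 by rewrite addr0.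
apply: orth_def; have {1}-> : w = - c *: v + x by rewrite xE scaleNr addKr.
by apply: orth_lin; apply/orthC/gen_pos_orth; eassumption.
Qed.

(** If W were orthogonal to [v], moving lowering operators across the form would make it orthogonal
    to all of [gen v], and [u0] to itself. So some u in W is not orthogonal to [v]; its coefficient
    on [v] is nonzero, and [gen_extract] puts [v] in W. *)
Lemma gen_simple lam v (W : V -> Prop) u0 :
    weight_vector lam v -> raised_to_0 v ->
    W 0 -> (forall c u w, W u -> W w -> W (c *: u + w)) ->
    (forall k l u, a k l -> W u -> W (e k l u)) -> (forall k, a k k) ->
    (forall u, W u -> gen v u) -> W u0 -> u0 != 0 ->
  forall u, gen v u -> W u.
Proof.
move=> wv rv W0 Wlin We arefl Wgen Wu0 u0_neq0.
have [u Wu nuv] : exists2 u, W u & ~ orth u v.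
  apply: contrapT => noW; move/eqP: u0_neq0; apply; apply: orth_def.
  have {}noW u : W u -> orth u v by move=> Wu; apply: contrapT => nu; apply: noW; exists u.
  have {noW} : forall y, gen v y -> forall u, W u -> orth y u.
    move=> y; elim=> [|c y1 y2 _ IH1 _ IH2|k l x kl _ IH] u Wu.
    - exact/orthC/noW.
    - by apply: orth_lin; [exact: IH1|exact: IH2].
    - apply: orth_adj; first by rewrite eq_sym below_neq.
      by apply: IH; apply: We => //; case/andP: kl.
  by apply=> //; apply: Wgen.
have Wv : W v.
  have [c [w [gw uE]]] := gen_split (Wgen _ Wu).
  have Wcv : W (c *: v).
    apply: (gen_extract wv W0 Wlin _ gw); last by rewrite -uE.
    by move=> k x; apply: We.
  have c0 : c != 0.
    apply: contra_notN nuv => /eqP c0; rewrite uE c0 scale0r add0r.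
    exact: gen_pos_orth gw.
  have := Wlin c^-1 _ _ Wcv W0; rewrite addr0 scalerA mulVf // scale1r.
  by [].
move=> x; elim=> // [c x1 x2 _ ? _ ?|k l y /andP[akl _] _ ?]; first exact: Wlin.
by apply: We; rewrite // a_sym.
Qed.

End Orthogonality.

End Lowering.

(** The sign makes [psign l] E_lk dual to E_kl for the supertrace form: str(psign l E_lk E_kl) =
    1. *)
Definition casimir v := \sum_k \sum_l psign l *: e k l (e l k v).

Lemma casimir_linear : linear casimir.
Proof.
move=> c x y; rewrite /casimir scaler_sumr -big_split; apply: eq_bigr => k _ /=.
rewrite scaler_sumr -big_split; apply: eq_bigr => l _ /=.
by rewrite !linearP /= scalerA mulrC -scalerA.
Qed.

(** The signs of passing E_kl and then E_lk multiply to 1, so an odd E_ab commutes without sign. The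
    commutators leave four single sums: the two in E_al E_lb cancel at once, the two in E_kb E_ak
    because their signs agree. *)
Lemma casimirC a b v : e a b (casimir v) = casimir (e a b v).
Proof.
have eCC k l : e a b (e k l (e l k v)) = e k l (e l k (e a b v))
    + ((ksign a b k l * (b == l)%:R) *: e k l (e a k v)
       - (k == a)%:R *: e k l (e l b v))
    + ((b == k)%:R *: e a l (e l k v)
       - (ksign a b k l * (l == a)%:R) *: e k b (e l k v)).
  have kk : ksign a b k l * ksign a b l k = 1.
    by rewrite /ksign [par l (+) _]addbC -expr2 sqrr_sign.
  rewrite eC [e a b (e l k v)]eC (linearB (e k l)) (linearD (e k l)) !(linearZ_LR (e k l)) /=.
  rewrite scalerBr scalerDr !scalerA !mulrA kk scale1r mul1r.
  by rewrite -!addrA.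
rewrite /casimir linear_sum.
transitivity (\sum_k \sum_l psign l *: e a b (e k l (e l k v))).
  by apply: eq_bigr => k _; rewrite linear_sum; apply: eq_bigr => l _; rewrite linearZ_LR.
under eq_bigr do under eq_bigr do rewrite eCC 2!scalerDr.
under eq_bigr do rewrite 2!big_split /=.
rewrite 2!big_split /= -[RHS]addr0 -addrA; congr (_ + _).
have sum1 (f : 'I_N -> V) i : \sum_k (k == i)%:R *: f k = f i.
  rewrite (bigD1 i) //= eqxx scale1r big1 ?addr0 // => k /negPf->.
  by rewrite scale0r.
under eq_bigr do under eq_bigr do rewrite scalerBr !scalerA.
under [X in _ + X]eq_bigr do under eq_bigr do rewrite scalerBr !scalerA.
under eq_bigr do rewrite sumrB.
under [X in _ + X]eq_bigr do rewrite sumrB.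
rewrite !sumrB.
have -> : \sum_k \sum_l (psign l * (ksign a b k l * (b == l)%:R)) *: e k l (e a k v)
    = \sum_k (psign b * ksign a b k b) *: e k b (e a k v).
  apply: eq_bigr => k _.
  rewrite -(sum1 (fun l => (psign l * ksign a b k l) *: e k l (e a k v)) b).
  by apply: eq_bigr => l _; rewrite scalerA eq_sym mulrA mulrC.
have -> : \sum_k \sum_l (psign l * (ksign a b k l * (l == a)%:R)) *: e k b (e l k v)
    = \sum_k (psign a * ksign a b k a) *: e k b (e a k v).
  apply: eq_bigr => k _.
  rewrite -(sum1 (fun l => (psign l * ksign a b k l) *: e k b (e l k v)) a).
  by apply: eq_bigr => l _; rewrite scalerA mulrA mulrC.
have -> : \sum_k \sum_l (psign l * (k == a)%:R) *: e k l (e l b v)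
    = \sum_l psign l *: e a l (e l b v).
  rewrite -(sum1 (fun k => \sum_l psign l *: e k l (e l b v)) a).
  apply: eq_bigr => k _; rewrite scaler_sumr; apply: eq_bigr => l _.
  by rewrite scalerA mulrC.
have -> : \sum_k \sum_l (psign l * (b == k)%:R) *: e a l (e l k v)
    = \sum_l psign l *: e a l (e l b v).
  rewrite -(sum1 (fun k => \sum_l psign l *: e a l (e l k v)) b).
  apply: eq_bigr => k _; rewrite scaler_sumr; apply: eq_bigr => l _.
  by rewrite scalerA mulrC eq_sym.
rewrite addrA subrK; apply/eqP; rewrite subr_eq0; apply/eqP; apply: eq_bigr => k _.
congr (_ *: _); rewrite /psign /ksign -!signr_addb.
by case: (par a) (par b) (par k) => -[] [].
Qed.

Lemma gen_casimir a r c v u : casimir v = c *: v -> gen a r v u ->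
  casimir u = c *: u.
Proof.
move=> cv; elim=> // [c' x y _ cx _ cy|k l x _ _ cx].
  by rewrite casimir_linear cx cy scalerDr !scalerA mulrC.
by rewrite -casimirC cx linearZ_LR.
Qed.

Lemma casimir_split lam v : weight_vector lam v -> casimir v =
  (\sum_k psign k * lam k ^+ 2) *: v + \sum_(k < N) \sum_(l < N | (k < l)%N)
    (psign l *: e k l (e l k v) + psign k *: e l k (e k l v)).
Proof.
move=> wv; pose g (k l : 'I_N) := psign l *: e k l (e l k v).
transitivity (\sum_k (g k k + (\sum_(l < N | (k < l)%N) g k l
    + \sum_(l < N | (l < k)%N) g k l))).
  apply: eq_bigr => k _; rewrite (bigD1 k) //= (bigID (fun l : 'I_N => k < l)%N) /=.
  congr (_ + (_ + _)); apply: eq_bigl => l.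
    by case: ltngtP => [kl|kl|/val_inj->]; rewrite ?eqxx ?andbF // -?val_eqE /= gtn_eqF.
  by rewrite -leqNgt -val_eqE ltn_neqAle.
rewrite !big_split /= [X in _ + (_ + X)](exchange_big_dep xpredT) //= -big_split; congr (_ + _).
  rewrite scaler_suml; apply: eq_bigr => k _.
  by rewrite /g wv linearZ_LR /= wv !scalerA expr2 mulrA.
by apply: eq_bigr => k _; rewrite [RHS]big_split.
Qed.

(* The simple odd reflection in [x_k - x_l], where [l] immediately follows [k]
   in the order of the coordinates given by [r]. *)
Lemma odd_reflection (r r' : 'I_N -> nat) k l v :
    injective r -> r l = (r k).+1 -> par k != par l ->
    (forall i, r' i = r (tperm k l i)) ->
    (forall i j, (r i < r j)%N -> e i j v = 0) -> v != 0 ->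
  exists v', [/\ v' = v \/ v' = e l k v, v' != 0
    & forall i j, (r' i < r' j)%N -> e i j v' = 0].
Proof.
move=> r_inj rl parkl r'E hv v0.
have req i j : i != j -> r i != r j by apply: contra_neq => /r_inj.
have kl : k != l by apply: contraNneq parkl => ->.
(* Exchanging two adjacent coordinates reverses only the pair (k, l): any other pair increasing for
   [r'] was increasing for [r]. *)
have lt_old i j : (r' i < r' j)%N -> (i, j) != (l, k) ->
    (r i < r j)%N && ((i, j) != (k, l)).
  rewrite !r'E !xpair_eqE.
  case: tpermP => [->|->|/eqP ik /eqP il]; case: tpermP => [->|->|/eqP jk /eqP jl];
    rewrite ?eqxx ?ltnn ?(negPf kl) ?andbF ?andbT ?[l == k]eq_sym ?(negPf kl) //= ?rl;
    do ?[move/req: ik => ik]; do ?[move/req: il => il];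
    do ?[move/req: jk => jk]; do ?[move/req: jl => jl]; rewrite ?(negPf ik); try lia.
  - by move=> /ltnW-> _; apply: contraNneq jl => ->.
  - by move=> ik' _; rewrite ltnS ltnW //; apply: contraNneq ik => ->.
  - by move=> -> _; apply/nandP; left; apply: contraNneq ik => ->.
have [e0|e0] := eqVneq (e l k v) 0.
  exists v; split=> [||i j /lt_old ij]; [by left|by []|].
  by have [[-> ->]//|/ij/andP[/hv]] := eqVneq (i, j) (l, k).
exists (e l k v); split=> [||i j /lt_old ij]; [by right|by []|].
have [[-> ->]|/ij/andP[{}ij]] := eqVneq (i, j) (l, k).
  by rewrite odd_square // eq_sym.
(* The remaining commutators of E_ij with E_lk are E_ik, if j = l, and E_lj, if i = k. As nothing
   lies between k and l, both are raising for [r] and kill [v]. *)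
rewrite xpair_eqE => nij; rewrite eC hv // linear0 scaler0 add0r.
have -> : (j == l)%:R *: e i k v = 0.
  case: (eqVneq j l) ij nij => [->|_ _ _]; last by rewrite scale0r.
  rewrite rl ltnS leq_eqVlt andbT => /predU1P[/r_inj->|/hv->]; last by rewrite scaler0.
  by rewrite eqxx.
case: (eqVneq k i) ij nij => [<-|_ _ _]; last by rewrite mulr0 scale0r subr0.
rewrite /= => kj jl; rewrite hv ?scaler0 ?subr0 //.
by rewrite rl ltn_neqAle kj andbT -rl req // eq_sym.
Qed.


Definition raised_along s v :=
  forall i j, (index i s < index j s)%N -> e i j v = 0.

Lemma odd_reflection_seq s1 k l s2 v :
    uniq (s1 ++ k :: l :: s2) -> (forall i, i \in s1 ++ k :: l :: s2) ->
    par k != par l -> raised_along (s1 ++ k :: l :: s2) v -> v != 0 ->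
  exists v', [/\ v' = v \/ v' = e l k v, v' != 0
    & raised_along (s1 ++ l :: k :: s2) v'].
Proof.
set s := s1 ++ _ => us sall parkl rv v0.
apply: (@odd_reflection (index^~ s) (index^~ (s1 ++ l :: k :: s2)) k l v) => //.
- by move=> i j; apply: index_inj.
- move: us; rewrite /s cat_uniq /= !inE !negb_or => /and3P[_ /and3P[ks ls _] /andP[/andP[kl _] _]].
  by rewrite !index_cat (negPf ks) (negPf ls) /= !eqxx (negPf kl) addn0 addn1.
- move=> i; move: us; rewrite /s cat_uniq /= !inE !negb_or.
  move=> /and3P[_ /and3P[ks ls _] /andP[/andP[kl _] _]].
  rewrite !index_cat; case: tpermP => [->|->|/eqP ik /eqP il].
  + by rewrite (negPf ks) (negPf ls) /= ?[l == k]eq_sym ?(negPf kl) ?eqxx ?(negPf kl).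
  + by rewrite (negPf ks) (negPf ls) /= ?[l == k]eq_sym ?(negPf kl) ?eqxx ?(negPf kl).
  + by case: ifP => //= _; rewrite ![_ == i]eq_sym (negPf ik) (negPf il).
Qed.

(** [move1] carries the head of D leftwards through B, one reflection per element; that head then
    joins A and the rest of D follows. [P] transports properties preserved by every matrix unit. *)
Lemma odd_reflections (P : V -> Prop) A B D v :
    (forall k l u, P u -> P (e k l u)) ->
    (forall b d, b \in B -> d \in D -> par b != par d) ->
    uniq (A ++ B ++ D) -> (forall i, i \in A ++ B ++ D) ->
    raised_along (A ++ B ++ D) v -> v != 0 -> P v ->
  exists v', [/\ v' != 0, P v' & raised_along (A ++ D ++ B) v'].
Proof.
move=> Pe.
have move1 d E : forall A' B' u, (forall b, b \in B' -> par b != par d) ->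
    uniq (A' ++ B' ++ d :: E) -> (forall i, i \in A' ++ B' ++ d :: E) ->
    raised_along (A' ++ B' ++ d :: E) u -> u != 0 -> P u ->
  exists u', [/\ u' != 0, P u' & raised_along (A' ++ d :: B' ++ E) u'].
  move=> A' B'; elim: B' A' => [|b B' IH] A' u parB us sall ru u0 Pu.
    by exists u.
  have [||||||u1 [u10 Pu1 ru1]] := IH (rcons A' b) u; rewrite ?cat_rcons //.
    by move=> b' b'B; rewrite parB // inE b'B orbT.
  rewrite cat_rcons in ru1.
  have pm : perm_eq (A' ++ [:: b, d & B' ++ E]) (A' ++ (b :: B') ++ d :: E).
    by rewrite perm_cat2l perm_cons; apply/permPl/(perm_catCA [:: d]).
  have [|||u2 [u2E u20 ru2]] := odd_reflection_seq _ _ _ ru1 u10.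
  - by rewrite (perm_uniq pm).
  - by move=> i; rewrite (perm_mem pm).
  - by rewrite parB // mem_head.
  by exists u2; split=> //; case: u2E => ->; [|apply: Pe].
elim: D A v => [|d D IH] A v parBD us sall rv v0 Pv.
  by exists v; rewrite cats0 /= in rv *.
have [b|u [u0 Pu ru]] := move1 d D A B v _ us sall rv v0 Pv.
  by move=> bB; rewrite parBD // mem_head.
have pm : perm_eq (rcons A d ++ B ++ D) (A ++ B ++ d :: D).
  by rewrite cat_rcons perm_cat2l; apply/permPl/(perm_catCA [:: d]).
have [||||||v' [v'0 Pv' rv']] := IH (rcons A d) u; rewrite ?cat_rcons //.
- by move=> b d' bB d'D; rewrite parBD // inE d'D orbT.
- by rewrite -cat_rcons (perm_uniq pm).
- by move=> i; rewrite -cat_rcons (perm_mem pm).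
by exists v'; split=> //; rewrite -cat_rcons.
Qed.

End Operators.

(** * Morphisms and products of modules *)

Section Morphism.
Variables (V V' : lmodType F) (f : {linear V -> V'}).
Variables (e : 'I_N -> 'I_N -> {linear V -> V}) (e' : 'I_N -> 'I_N -> {linear V' -> V'}).
Hypothesis fe : forall k l u, f (e k l u) = e' k l (f u).
Variables (a : rel 'I_N) (r : 'I_N -> nat).

Lemma gen_morph v u : gen e a r v u -> gen e' a r (f v) (f u).
Proof.
elim=> [|c x y _ IHx _ IHy|k l x kl _ IHx]; first by constructor.
- by rewrite linearP; constructor.
- by rewrite fe; constructor.
Qed.

Lemma gen_pos_morph v w : gen_pos e a r v w -> gen_pos e' a r (f v) (f w).
Proof.
elim=> [|c x y _ IHx _ IHy|k l x kl gx]; first by rewrite linear0; constructor.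
- by rewrite linearP; constructor.
- by rewrite fe; constructor=> //; apply: gen_morph.
Qed.

End Morphism.

Section Product.
Variables (V V' : lmodType F).
Variables (e : 'I_N -> 'I_N -> {linear V -> V}) (e' : 'I_N -> 'I_N -> {linear V' -> V'}).

Definition prod_fun k l (u : V * V') : V * V' := (e k l u.1, e' k l u.2).

Lemma prod_fun_linear k l : linear (prod_fun k l).
Proof. by move=> c u v; rewrite /prod_fun !linearP. Qed.

HB.instance Definition _ k l := GRing.isLinear.Build F (V * V')%type (V * V')%type _
  (prod_fun k l) (prod_fun_linear k l).

Definition prod_op k l : {linear (V * V')%type -> (V * V')%type} := prod_fun k l.

Lemma prod_opE k l u : prod_op k l u = (e k l u.1, e' k l u.2).
Proof. by []. Qed.

Lemma prod_gl_module : gl_module e -> gl_module e' -> gl_module prod_op.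
Proof. by move=> eC eC' a b k l u; rewrite !prod_opE eC eC'. Qed.

Lemma prod_weight lam v v' : weight_vector e lam v -> weight_vector e' lam v' ->
  weight_vector prod_op lam (v, v').
Proof. by move=> wv wv' k; rewrite prod_opE wv wv'. Qed.

Lemma prod_raised a r v v' : raised_to_0 e a r v -> raised_to_0 e' a r v' ->
  raised_to_0 prod_op a r (v, v').
Proof. by move=> rv rv' k l kl; rewrite prod_opE rv ?rv'. Qed.

End Product.
End GlModule.

(** * Representations of [galg] as gl(m|n)-modules *)

Section SuperalgebraModules.
Variables (R : realType) (m n : nat).
Local Notation C := R[i].
Local Notation Mat := 'M[C]_(m + n).
Local Notation galg := (galg R m n).
Local Notation cartan := (cartan R m n).

Definition parity (k : 'I_(m + n)) : bool := (m <= k)%N.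

Definition scalar_part (X : Mat) : C :=
  if m == n then 0 else supertrace X / (m%:R - n%:R).

(* Projection of gl(m|n) onto [galg] along the scalar matrices when m != n: it
   makes every representation of [galg] a representation of gl(m|n). *)
Definition glproj (X : Mat) : Mat := X - (scalar_part X)%:M.

Lemma scalar_part_linear : linear (scalar_part : Mat -> C^o).
Proof.
move=> c X Y; rewrite /scalar_part; case: ifP => _; first by rewrite scaler0 addr0.
by rewrite (linearP (@supertrace R m n : Mat -> C^o)) /GRing.scale /= mulrDl mulrA.
Qed.

Lemma glproj_linear : linear glproj.
Proof.
move=> c X Y; rewrite /glproj scalar_part_linear raddfD /= opprD addrACA.
by congr (_ + _); rewrite scalerBr scale_scalar_mx.
Qed.

HB.instance Definition _ := GRing.isLinear.Build C Mat Mat _ glproj glproj_linear.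

Lemma supertrace_scalar a : supertrace (a%:M : Mat) = (m%:R - n%:R) * a.
Proof.
rewrite supertraceE big_split_ord mulrBl !mulr_natl -[in RHS](card_ord m) -[in RHS](card_ord n).
rewrite -!sumr_const -sumrN; congr (_ + _); apply: eq_bigr => i _.
  by rewrite mxE eqxx /= leqNgt ltn_ord mul1r.
by rewrite mxE eqxx /= leq_addr mulN1r.
Qed.

Lemma supertrace_delta k l :
  supertrace (delta_mx k l : Mat) = (-1) ^+ parity k * (k == l)%:R.
Proof.
rewrite supertraceE (bigD1 k) //= mxE eqxx /= big1 ?addr0 // => i ik.
by rewrite mxE (negPf ik) mulr0.
Qed.

Lemma glproj_galg X : glproj X \in galg.
Proof.
rewrite /Defs.galg /glproj /scalar_part; case: ifPn => [_|mn]; first exact: memvf.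
rewrite mem_sl (raddfB (@supertrace R m n : Mat -> C^o)) /= supertrace_scalar.
by rewrite mulrCA mulfV ?mulr1 ?subrr // subr_eq0 eqr_nat.
Qed.

Lemma glproj_id X : X \in galg -> glproj X = X.
Proof.
rewrite /Defs.galg /glproj /scalar_part; case: ifPn => _; first by rewrite raddf0 subr0.
by rewrite mem_sl => /eqP ->; rewrite mul0r raddf0 subr0.
Qed.

Lemma scalar_part_delta k l : k != l -> scalar_part (delta_mx k l) = 0.
Proof.
by move=> kl; rewrite /scalar_part supertrace_delta (negPf kl) mulr0 mul0r if_same.
Qed.

Lemma glproj_delta k l : k != l -> glproj (delta_mx k l) = delta_mx k l.
Proof. by move=> kl; rewrite /glproj scalar_part_delta // raddf0 subr0. Qed.

Lemma delta_galg k l : k != l -> delta_mx k l \in galg.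
Proof. by move=> /glproj_delta <-; apply: glproj_galg. Qed.

Lemma parity_lshift i : parity (lshift n i) = false.
Proof. by rewrite /parity leqNgt /= ltn_ord. Qed.

Lemma parity_rshift i : parity (rshift m i) = true.
Proof. by rewrite /parity leq_addr. Qed.

Lemma homogP z (X : Mat) :
  homog z X <-> forall k l, parity k (+) parity l != z -> X k l = 0.
Proof.
split; last first.
  move=> Xz; case: z Xz => Xz; split; apply/matrixP => i j; rewrite !mxE; apply: Xz;
  by rewrite ?parity_lshift ?parity_rshift.
case: z => -[X1 X2] k l.
  rewrite -(splitK k) -(splitK l); case: (split k) => i; case: (split l) => j /=;
  rewrite ?parity_lshift ?parity_rshift //= => _.
    by have /matrixP/(_ i j) := X1; rewrite !mxE.
  by have /matrixP/(_ i j) := X2; rewrite !mxE.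
rewrite -(splitK k) -(splitK l); case: (split k) => i; case: (split l) => j /=;
rewrite ?parity_lshift ?parity_rshift //= => _.
  by have /matrixP/(_ i j) := X1; rewrite !mxE.
by have /matrixP/(_ i j) := X2; rewrite !mxE.
Qed.

Lemma homog_glproj_delta k l :
  homog (parity k (+) parity l) (glproj (delta_mx k l)).
Proof.
apply/homogP => i j pne; rewrite /glproj !mxE; have [ij|ij] := eqVneq i j.
  have [kl|kl] := eqVneq k l; first by rewrite ij kl !addbb in pne.
  rewrite scalar_part_delta // mul0rn subr0 -ij.
  by case: eqVneq => //= ->; rewrite (negPf kl).
rewrite mulr0n subr0; have [ik|//] := eqVneq i k; have [jl|//] := eqVneq j l.
by rewrite ik jl eqxx in pne.
Qed.

(** Only diagonal units have a nonzero scalar part, and they are even; scalar matrices then drop out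
    of the superbracket, which is an ordinary commutator there. *)
Lemma glproj_sbracket a b k l :
  sbracket (parity a (+) parity b) (parity k (+) parity l)
    (glproj (delta_mx a b)) (glproj (delta_mx k l))
  = glproj ((b == k)%:R *: delta_mx a l
      - (ksign C parity a b k l * (l == a)%:R) *: delta_mx k b).
Proof.
set z := parity a (+) parity b; set w := parity k (+) parity l.
have sZ X c : (1 - (-1) ^+ (z && w)) * c = 0 -> c *: X = (-1) ^+ (z && w) *: (c *: X) :> Mat.
  by move=> /eqP; rewrite mulrBl mul1r subr_eq0 => /eqP {1}->; rewrite scalerA.
have sx : (1 - (-1) ^+ (z && w)) * scalar_part (delta_mx a b) = 0.
  rewrite /z; case: (eqVneq a b) => [->|/scalar_part_delta->]; last by rewrite mulr0.
  by rewrite addbb /= subrr mul0r.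
have sy : (1 - (-1) ^+ (z && w)) * scalar_part (delta_mx k l) = 0.
  rewrite /w; case: (eqVneq k l) => [->|/scalar_part_delta->]; last by rewrite mulr0.
  by rewrite addbb andbF /= subrr mul0r.
rewrite /sbracket {1 2}/glproj.
set x := scalar_part (delta_mx a b); set y := scalar_part (delta_mx k l).
have -> : (delta_mx a b - x%:M) *m (delta_mx k l - y%:M) -
    (-1) ^+ (z && w) *: ((delta_mx k l - y%:M) *m (delta_mx a b - x%:M)) =
  delta_mx a b *m delta_mx k l - (-1) ^+ (z && w) *: (delta_mx k l *m delta_mx a b) :> Mat.
  rewrite !mulmxBl !mulmxBr !mul_mx_scalar !mul_scalar_mx.
  rewrite !scalerBr -(sZ (delta_mx a b) _ sy) -(sZ (delta_mx k l) _ sx).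
  have -> : (-1) ^+ (z && w) *: (x *: y%:M) = y *: x%:M :> Mat.
    by rewrite -(sZ _ _ sx) !scale_scalar_mx mulrC.
  rewrite -/x -/y.
  move: (y *: x%:M) (x *: delta_mx k l) (y *: delta_mx a b) => X1 X2 X3.
  move: (delta_mx a b *m _) (_ *: (delta_mx k l *m _)) => X4 X5.
  by apply/matrixP => i j; rewrite !mxE; ring.
rewrite !mul_delta_mx_cond -[delta_mx a l *+ _]scaler_nat -[delta_mx k b *+ _]scaler_nat.
rewrite scalerA -/(ksign C parity a b k l).
rewrite /glproj -[LHS]subr0; congr (_ - _).
(* A superbracket has supertrace 0, so projecting it changes nothing. *)
suff -> : scalar_part ((b == k)%:R *: delta_mx a l -
  (ksign C parity a b k l * (l == a)%:R) *: delta_mx k b) = 0 by rewrite raddf0.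
rewrite /scalar_part; case: ifP => // _.
rewrite (raddfB (@supertrace R m n : Mat -> C^o)) /=.
rewrite !(linearZ_LR (@supertrace R m n : Mat -> C^o)) /= !supertrace_delta.
rewrite /GRing.scale /= /ksign; have [->|bk] := eqVneq b k; last first.
  by rewrite mul0r sub0r !mulr0 oppr0 mul0r.
have [->|la] := eqVneq l a; last first.
  by rewrite !(mulr0, mul0r) subr0 mul0r.
rewrite !mulr1 mul1r -signr_addb.
by case: (parity a) (parity k) => -[]; rewrite /= subrr mul0r.
Qed.


End SuperalgebraModules.
Arguments parity {m n} k.

Section SuperalgebraWeights.
Variables (R : realType) (m n : nat).
Local Notation C := R[i].
Local Notation Mat := 'M[C]_(m + n).
Local Notation galg := (galg R m n).
Local Notation cartan := (cartan R m n).
Local Notation weight := (weight R m n).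

Lemma glproj_diag_cartan k : glproj (delta_mx k k : Mat) \in cartan.
Proof.
rewrite mem_cartan glproj_galg andbT; apply/is_diag_mxP => i j; rewrite val_eqE => ij.
rewrite /glproj !mxE (negPf ij) mulr0n subr0.
by have [ik|//] := eqVneq i k; rewrite ik eq_sym in ij; rewrite (negPf ij).
Qed.

Definition hvec k : subvs_of cartan := Subvs (glproj_diag_cartan k).

(** Pairing with [mu] is evaluation at [tvec mu], so (mu, x_k - x_l) is the difference of the
    coordinates k and l. *)
Definition tcoord (mu : weight) k : C := vsval (tvec mu) k k.

Lemma cartan_diag (T : subvs_of cartan) i j : i != j -> vsval T i j = 0.
Proof.
move=> ij; have := subvsP T; rewrite mem_cartan => /andP[/is_diag_mxP Td _].
exact: Td.
Qed.

Lemma cartan_galg (T : subvs_of cartan) : vsval T \in galg.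
Proof. by have := subvsP T; rewrite mem_cartan => /andP[]. Qed.

Lemma strform_cartan (T S : subvs_of cartan) :
  strform (vsval T) (vsval S) = \sum_k (-1) ^+ parity k * (vsval T k k * vsval S k k).
Proof.
rewrite /strform supertraceE; apply: eq_bigr => k _; congr (_ * _).
rewrite mxE (bigD1 k) //= big1 ?addr0 // => i ik.
by rewrite cartan_diag ?mul0r // eq_sym.
Qed.

(** The sign is that of the supertrace form. The scalar subtracted in [hvec k] pairs to 0 with
    [tvec mu], whose supertrace vanishes when m != n. *)
Lemma weight_hvec (mu : weight) k : mu (hvec k) = (-1) ^+ parity k * tcoord mu k.
Proof.
rewrite tvecP /strform /= /glproj mulmxBr (raddfB (@supertrace R m n : Mat -> C^o)) /=.
rewrite mul_mx_scalar (linearZ_LR (@supertrace R m n : Mat -> C^o)) /=.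
have -> : scalar_part (delta_mx k k) *: supertrace (vsval (tvec mu)) = 0 :> C^o.
  rewrite /scalar_part; case: ifPn => mn; first by rewrite scale0r.
  have := cartan_galg (tvec mu); rewrite /Defs.galg (negPf mn) mem_sl => /eqP->.
  by rewrite scaler0.
rewrite subr0 supertraceE (bigD1 k) //= mxE (bigD1 k) //= mxE !eqxx mulr1.
rewrite big1 ?addr0 => [|i ik]; last by rewrite mxE (negPf ik) mulr0.
rewrite big1 ?addr0 // => i ik; rewrite mxE big1 ?mulr0 // => j _.
by rewrite mxE (negPf ik) andbF mulr0.
Qed.

Lemma wformE (lam mu : weight) : wform lam mu = lam (tvec mu).
Proof. by rewrite tvecP. Qed.

Lemma wformC (lam mu : weight) : wform lam mu = wform mu lam.
Proof.
rewrite /wform !strform_cartan; apply: eq_bigr => k _.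
by rewrite [_ k k * _]mulrC.
Qed.

Lemma wform_self (mu : weight) :
  wform mu mu = \sum_k (-1) ^+ parity k * tcoord mu k ^+ 2.
Proof. by rewrite /wform strform_cartan. Qed.

Lemma rootw_tvec (mu : weight) k l : rootw R k l (tvec mu) = tcoord mu k - tcoord mu l.
Proof. by rewrite !lfunE /= !lfunE /= !coordwE. Qed.

Lemma pos_evenE (k l : 'I_(m + n)) :
  pos_even k l = (parity k == parity l) && (k < l)%N.
Proof.
rewrite /pos_even; case: split_ordP => i ->; case: split_ordP => j -> /=.
- by rewrite !parity_lshift.
- by rewrite parity_lshift parity_rshift.
- by rewrite parity_lshift parity_rshift.
- by rewrite !parity_rshift /= ltn_add2l.
Qed.

Lemma pos_stE (k l : 'I_(m + n)) : pos_st k l = (k < l)%N.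
Proof.
rewrite /pos_st /pos_even; case: split_ordP => i ->; case: split_ordP => j -> /=.
- by rewrite orbF.
- by rewrite ltn_addr.
- by rewrite ltnNge ltnW // ltn_addr.
- by rewrite orbF ltn_add2l.
Qed.

Lemma odd_rootE (k l : 'I_(m + n)) : odd_root k l = parity k (+) parity l.
Proof. by rewrite /odd_root /parity !ltnNge; case: (_ <= _)%N (_ <= _)%N => -[]. Qed.

Lemma rho_st_tvec (mu : weight) : (2%:R *: rho pos_st) (tvec mu) =
  \sum_(k < m + n) \sum_(l < m + n | (k < l)%N)
    (-1) ^+ (parity k (+) parity l) * (tcoord mu k - tcoord mu l).
Proof.
rewrite /rho /rho_part -scalerBr scalerA mulfV ?scale1r ?pnatr_eq0 //.
rewrite !lfunE /= !lfunE /= !sum_lfunE -sumrB; apply: eq_bigr => k _.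
rewrite !sum_lfunE [RHS](bigID (fun l => parity k (+) parity l)) /= [RHS]addrC -sumrN.
congr (_ + _).
  apply: eq_big => [l|l /andP[_]]; first by rewrite pos_stE odd_rootE; case: (_ (+) _).
  by rewrite odd_rootE rootw_tvec => /eqP->; rewrite mul1r.
apply: eq_big => [l|l /andP[_]]; first by rewrite pos_stE odd_rootE; case: (_ (+) _).
by rewrite odd_rootE rootw_tvec => /eqP->; rewrite mulN1r.
Qed.

Section Representation.
Variable H : srep R m n.

Definition eact k l : H -> H := act (glproj (delta_mx k l)).

Lemma eact_linear k l : linear (eact k l).
Proof. by move=> c u v; apply: act_linearr; apply: glproj_galg. Qed.

HB.instance Definition _ k l := GRing.isLinear.Build C H H _ (eact k l) (eact_linear k l).

Fact eop_exists k l :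
  {f : {linear H -> H} | forall v, f v = act (glproj (delta_mx k l)) v}.
Proof. by exists (eact k l). Qed.

(* Defined through an opaque proof so that simplification does not expand it. *)
Definition eop k l : {linear H -> H} := sval (eop_exists k l).

Lemma eop_glproj k l v : eop k l v = act (glproj (delta_mx k l)) v.
Proof. exact: (svalP (eop_exists k l)). Qed.

Lemma eopE k l v : k != l -> eop k l v = act (delta_mx k l) v.
Proof. by move=> kl; rewrite eop_glproj glproj_delta. Qed.

Definition act_on (v : H) (X : Mat) : H := act (glproj X) v.

Lemma act_on_linear v : linear (act_on v).
Proof. by move=> c X Y; rewrite /act_on linearP act_linearl ?glproj_galg. Qed.

HB.instance Definition _ v := GRing.isLinear.Build C Mat H _ (act_on v) (act_on_linear v).

Lemma act_sum X (v : H) : X \in galg ->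
  act X v = \sum_k \sum_l X k l *: eop k l v.
Proof.
move=> gX; have -> : act X v = act_on v X by rewrite /act_on glproj_id.
rewrite {1}[X]matrix_sum_delta linear_sum; apply: eq_bigr => k _.
by rewrite linear_sum; apply: eq_bigr => l _; rewrite linearZ_LR eop_glproj.
Qed.

Lemma eop_gl_module : gl_module parity eop.
Proof.
move=> a b k l v.
have := act_bracket v (glproj_galg (delta_mx a b)) (glproj_galg (delta_mx k l))
  (homog_glproj_delta R a b) (homog_glproj_delta R k l).
rewrite glproj_sbracket -[act (glproj _) v]/(act_on v _) (linearB (act_on v)).
rewrite !(linearZ_LR (act_on v)).
by rewrite !eop_glproj; move/eqP; rewrite eq_sym subr_eq addrC addrA => /eqP.
Qed.

Lemma part0 z : part z (0 : H).
Proof. by have [] := part_subspace H z. Qed.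

Lemma part_lin z c (u v : H) : part z u -> part z v -> part z (c *: u + v).
Proof. by have [_] := part_subspace H z; apply. Qed.

Lemma part_eop z k l (v : H) : part z v ->
  part (parity k (+) parity l (+) z) (eop k l v).
Proof. by rewrite eop_glproj; apply: act_part; [apply: glproj_galg|apply: homog_glproj_delta]. Qed.

Lemma hwv_weight pos lam (v : H) : highest_weight_vector pos lam v ->
  weight_vector eop (fun k => lam (hvec k)) v.
Proof. by case=> _ hv _ k; rewrite eop_glproj -hv. Qed.

Lemma hwv_raised (pos : rel 'I_(m + n)) lam (v : H) k l :
  highest_weight_vector pos lam v -> k != l -> pos k l -> eop k l v = 0.
Proof. by case=> _ _ hv kl /hv <-; rewrite eopE. Qed.

Lemma hwv_intro (pos : rel 'I_(m + n)) lam (v : H) :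
    v != 0 -> weight_vector eop lam v -> irreflexive pos ->
    (forall k l, pos k l -> eop k l v = 0) ->
  highest_weight_vector pos (\sum_k lam k *: coordw R k) v.
Proof.
move=> v0 wv irr rv; split=> // [T|k l kl]; last first.
  by rewrite -eopE ?rv //; apply: contraTneq kl => ->; rewrite irr.
rewrite act_sum ?cartan_galg // sum_lfunE scaler_suml; apply: eq_bigr => k _.
rewrite (bigD1 k) //= big1 ?addr0 => [|l lk]; last first.
  by rewrite cartan_diag ?scale0r // eq_sym.
by rewrite wv scalerA lfunE /= coordwE mulrC.
Qed.

Lemma act0 X : X \in galg -> act X (0 : H) = 0.
Proof.
move=> gX; rewrite act_sum // big1 // => k _; rewrite big1 // => l _.
by rewrite linear0 scaler0.
Qed.

Lemma actZr X c (v : H) : X \in galg -> act X (c *: v) = c *: act X v.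
Proof. by move=> gX; have := act_linearr c v 0 gX; rewrite !addr0 act0 // addr0. Qed.

Lemma hwv_weight_unique pos pos' lam mu c (v : H) :
  highest_weight_vector pos lam v -> highest_weight_vector pos' mu (c *: v) -> lam = mu.
Proof.
move=> [_ lv _] [cv0 mv _]; apply/lfunP => T; apply/eqP; rewrite -subr_eq0.
have : (lam T - mu T) *: (c *: v) == 0.
  by rewrite scalerBl -mv actZr ?cartan_galg // lv !scalerA mulrC subrr.
by rewrite scaler_eq0 (negPf cv0) orbF.
Qed.

End Representation.
End SuperalgebraWeights.

(** * Uniqueness of simple highest weight modules *)

Section HighestWeightModules.
Variables (R : realType) (m n : nat).
Local Notation C := R[i].
Local Notation Mat := 'M[C]_(m + n).
Local Notation galg := (galg R m n).
Variable r : 'I_(m + n) -> nat.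
Hypothesis r_inj : injective r.

Lemma part_decomp (H : srep R m n) (u v u' v' : H) z :
  part z u -> part (~~ z) v -> part z u' -> part (~~ z) v' ->
  u + v = u' + v' -> u = u' /\ v = v'.
Proof.
move=> zu zv zu' zv' uv.
have partB y (x1 x2 : H) : part y x1 -> part y x2 -> part y (x1 - x2).
  by move=> p1 p2; rewrite addrC -scaleN1r; apply: part_lin.
have E : u - u' = v' - v by rewrite -[u](addrK v) uv addrAC [u' + v']addrC addrK.
have d0 : v' - v = 0.
  have [pz pnz] : part z (v' - v) /\ part (~~ z) (v' - v).
    by split; [rewrite -E|]; apply: partB.
  by case: z pz pnz {zu zv zu' zv' E} => pz pnz; apply: part_direct.
by split; apply/eqP; [|rewrite eq_sym]; rewrite -subr_eq0 ?E d0.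
Qed.

Lemma subrep_gen (H : srep R m n) lam (v : H) z :
    weight_vector (eop H) lam v -> raised_to_0 (eop H) full_rel r v -> part z v ->
  subrep (gen (eop H) full_rel r v : set H).
Proof.
move=> wv rv zv; split.
- by split=> [|c x y gx gy]; [exact: gen0|exact: gen_lin].
- move=> v0 v1 p0 p1 gv.
  have [f Pf E] := gen_graded (P := @part _ _ _ H) (@part0 _ _ _ H)
    (fun y c x1 x2 => @part_lin _ _ _ H y c x1 x2)
    (fun y k l w => @part_eop _ _ _ H y k l w) zv gv.
  have [g0 p0f] := Pf false; have [g1 p1f] := Pf true.
  by have [-> ->] := part_decomp p0 p1 p0f p1f E.
- move=> X x gX gx; rewrite act_sum //.
  elim/big_rec: _ => [|k y _ gy]; first exact: gen0.
  apply: genD gy; elim/big_rec: _ => [|l y' _ gy']; first exact: gen0.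
  apply: gen_lin gy'.
  exact: (gen_stable (@eop_gl_module _ _ _ H) (@full_rel_sym _) (@full_rel_trans _)
    r_inj wv rv).
Qed.

Lemma simple_gen (H : srep R m n) lam (v u : H) z :
    simple_rep H -> v != 0 -> weight_vector (eop H) lam v ->
    raised_to_0 (eop H) full_rel r v -> part z v ->
  gen (eop H) full_rel r v u.
Proof.
move=> [_ sH] v0 wv rv zv; have [E|E] := sH _ (subrep_gen wv rv zv).
  have : gen (eop H) full_rel r v v by constructor.
  by move: v0; rewrite E => /negP v0 /= /eqP.
by have : [set: H]%classic u by []; rewrite -E.
Qed.

Section Isomorphism.
Variables (H K : srep R m n) (lam : 'I_(m + n) -> C) (h : H) (k0 : K) (z : bool).
Hypotheses (sH : simple_rep H) (sK : simple_rep K) (h0 : h != 0) (k00 : k0 != 0)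
  (wh : weight_vector (eop H) lam h) (wk : weight_vector (eop K) lam k0)
  (rh : raised_to_0 (eop H) full_rel r h) (rk : raised_to_0 (eop K) full_rel r k0)
  (ph : part z h) (pk : part false k0).

Let eop2 := prod_op (eop H) (eop K).

Let eop2_gl : gl_module parity eop2.
Proof. by apply: prod_gl_module; apply: eop_gl_module. Qed.

(* The submodule of [H * K] generated by [(h, k0)] is the graph of the
   isomorphism. *)
Let graph (x : H) (y : K) := gen eop2 full_rel r (h, k0) (x, y).

Let graph_lin c x y x' y' : graph x y -> graph x' y' ->
  graph (c *: x + x') (c *: y + y').
Proof. by move=> g g'; have := gen_lin c g g'. Qed.

Let graph0 : graph 0 0.
Proof. exact: (gen0 eop2 full_rel r (h, k0)). Qed.

Let w2 : weight_vector eop2 lam (h, k0).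
Proof. exact: prod_weight. Qed.

Let r2 : raised_to_0 eop2 full_rel r (h, k0).
Proof. exact: prod_raised. Qed.

Let graph_act X x y : X \in galg -> graph x y -> graph (act X x) (act X y).
Proof.
move=> gX g; rewrite /graph.
have -> : (act X x, act X y) = \sum_k \sum_l X k l *: eop2 k l (x, y).
  rewrite [RHS]surjective_pairing !raddf_sum; congr (_, _).
    by rewrite act_sum //; apply: eq_bigr => k _; rewrite raddf_sum.
  by rewrite act_sum //; apply: eq_bigr => k _; rewrite raddf_sum.
elim/big_rec: _ => [|k u _ gu]; first exact: gen0.
apply: genD gu; elim/big_rec: _ => [|l u' _ gu]; first exact: gen0.
apply: gen_lin gu.
exact: (gen_stable eop2_gl (@full_rel_sym _) (@full_rel_trans _) r_inj w2 r2).
Qed.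

Let graph_split x0 x1 y0 y1 :
  part z x0 -> part (~~ z) x1 -> part false y0 -> part true y1 ->
  graph (x0 + x1) (y0 + y1) -> graph x0 y0 /\ graph x1 y1.
Proof.
move=> px0 px1 py0 py1 g.
(* The grading of H is shifted by [z], the parity of [h], so that the generator (h, k0) is even. *)
pose P y (u : H * K) := part (z (+) y) u.1 /\ part y u.2.
have [f Pf E] : exists2 f : bool -> H * K,
    (forall y, gen eop2 full_rel r (h, k0) (f y) /\ P y (f y))
    & (x0 + x1, y0 + y1) = f false + f true.
  apply: (gen_graded (par := parity) (z := false)) g => //.
  - by move=> y; split; apply: part0.
  - by move=> y c u1 u2 [? ?] [? ?]; split; apply: part_lin.
  - move=> y k l [w1 w2'] [/= p1 p2]; split; last exact: part_eop.
    by rewrite addbCA; apply: part_eop.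
  - by split; rewrite /= ?addbF.
have [g0 [p01 p02]] := Pf false; have [g1 [p11 p12]] := Pf true.
case: E => E1 E2; rewrite addbF in p01; rewrite addbT in p11.
have [-> ->] := part_decomp px0 px1 p01 p11 E1.
have [-> ->] := part_decomp py0 py1 p02 p12 E2.
by rewrite /graph -!surjective_pairing.
Qed.

Let graph_splitH x0 x1 y : part false x0 -> part true x1 -> graph (x0 + x1) y ->
  exists y0 y1, graph x0 y0 /\ graph x1 y1.
Proof.
move=> p0 p1 g; have [y0 [y1 [q0 q1 E]]] := part_span y.
have [zE|zE] := boolP z.
  have := @graph_split x1 x0 y0 y1; rewrite zE addrC -E => /(_ p1 p0 q0 q1 g)[? ?].
  by exists y1, y0.
have := @graph_split x0 x1 y0 y1; rewrite (negPf zE) -E => /(_ p0 p1 q0 q1 g)[? ?].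
by exists y0, y1.
Qed.

Let graph_splitK x y0 y1 : part false y0 -> part true y1 -> graph x (y0 + y1) ->
  exists x0 x1, [/\ graph x0 y0, graph x1 y1 & x = x0 + x1].
Proof.
move=> q0 q1 g; have [x0 [x1 [p0 p1 E]]] := part_span x.
have [zE|zE] := boolP z.
  have := @graph_split x1 x0 y0 y1; rewrite zE addrC -E => /(_ p1 p0 q0 q1 g)[? ?].
  by exists x1, x0; rewrite addrC.
have := @graph_split x0 x1 y0 y1; rewrite (negPf zE) -E => /(_ p0 p1 q0 q1 g)[? ?].
by exists x0, x1.
Qed.

Let graph_base x y : graph x y -> exists c w1 w2,
  [/\ x = c *: h + w1, y = c *: k0 + w2,
      gen_pos (eop H) full_rel r h w1 & gen_pos (eop K) full_rel r k0 w2].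
Proof.
move=> /gen_split[c [w [gw [-> ->]]]]; exists c, w.1, w.2; split=> //.
  exact: (gen_pos_morph (f := fst) (e' := eop H) _ gw).
exact: (gen_pos_morph (f := snd) (e' := eop K) _ gw).
Qed.

(** An element of the graph has the same coefficient on [h] and on [k0], and [gen_pos_indep] makes
    each coefficient well defined. *)
Let not_graph_base (c c' : C) : c != c' -> ~ graph (c *: h) (c' *: k0).
Proof.
move=> cc' /graph_base[d [w1 [w2' [E1 E2 g1 g2]]]].
have d1 : d - c = 0.
  apply: (gen_pos_indep (@eop_gl_module _ _ _ H) wh h0 g1).
  by rewrite scalerBl addrAC -E1 subrr.
have d2 : d - c' = 0.
  apply: (gen_pos_indep (@eop_gl_module _ _ _ K) wk k00 g2).
  by rewrite scalerBl addrAC -E2 subrr.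
by move: cc'; rewrite -(subr0_eq d1) -(subr0_eq d2) eqxx.
Qed.

(** The fibres of the graph over 0 and its two projections are subrepresentations of simple modules.
    The fibres are proper by [not_graph_base], hence zero; the projections contain [h] or [k0],
    hence are everything. *)
Let graph_functional y : graph 0 y -> y = 0.
Proof.
have [_ /(_ (fun y => graph 0 y))] := sK; case=> [|E|E].
- split.
  + split; first exact: graph0.
    by move=> c u v gu gv; have := graph_lin c gu gv; rewrite scaler0 addr0.
  + move=> y0 y1 q0 q1 g; apply: graph_split; rewrite ?addr0 //; exact: part0.
  + by move=> X y' gX g; have := graph_act gX g; rewrite act0.
- by move=> g; have : [set 0]%classic y by rewrite -E.
have : graph 0 k0 by have : [set: K]%classic k0 by []; rewrite -E.
rewrite -(scale0r h) -(scale1r k0) => /not_graph_base.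
by rewrite eq_sym oner_neq0 => /(_ isT).
Qed.

Let graph_injective x : graph x 0 -> x = 0.
Proof.
have [_ /(_ (fun x => graph x 0))] := sH; case=> [|E|E].
- split.
  + split; first exact: graph0.
    by move=> c u v gu gv; have := graph_lin c gu gv; rewrite scaler0 addr0.
  + move=> x0 x1 p0 p1 g; have := @graph_split; case: z => gs.
      by have [] := gs x1 x0 0 0 p1 p0 (part0 _ _) (part0 _ _); rewrite ?addr0 // addrC.
    by apply: gs; rewrite ?addr0 //; exact: part0.
  + by move=> X x' gX g; have := graph_act gX g; rewrite act0.
- by move=> g; have : [set 0]%classic x by rewrite -E.
have : graph h 0 by have : [set: H]%classic h by []; rewrite -E.
by rewrite -(scale0r k0) -(scale1r h) => /not_graph_base; rewrite oner_neq0 => /(_ isT).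
Qed.

Let graph_total x : exists y, graph x y.
Proof.
have ghk : graph h k0 by constructor.
have [_ /(_ (fun x => exists y, graph x y))] := sH; case=> [|E|E].
- split.
  + split; first by exists 0; apply: graph0.
    by move=> c u v [y gu] [y' gv]; exists (c *: y + y'); apply: graph_lin.
  + move=> x0 x1 p0 p1 [y /(graph_splitH p0 p1)[y0 [y1 [g0 g1]]]].
    by split; [exists y0|exists y1].
  + by move=> X x' gX [y g]; exists (act X y); apply: graph_act.
- have : [set 0]%classic h by rewrite -E; exists k0.
  by move: h0 => /[swap] /= ->; rewrite eqxx.
by have : [set: H]%classic x by []; rewrite -E.
Qed.

Let graph_surjective y : exists x, graph x y.
Proof.
have ghk : graph h k0 by constructor.
have [_ /(_ (fun y => exists x, graph x y))] := sK; case=> [|E|E].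
- split.
  + split; first by exists 0; apply: graph0.
    by move=> c u v [x gu] [x' gv]; exists (c *: x + x'); apply: graph_lin.
  + move=> y0 y1 q0 q1 [x /(graph_splitK q0 q1)[x0 [x1 [g0 g1 _]]]].
    by split; [exists x0|exists x1].
  + by move=> X y' gX [x g]; exists (act X x); apply: graph_act.
- have : [set 0]%classic k0 by rewrite -E; exists h.
  by move: k00 => /[swap] /= ->; rewrite eqxx.
by have : [set: K]%classic y by []; rewrite -E.
Qed.

(** The map shifts parity by [z] and intertwines the actions without sign, which fits [parity_rev]:
    it changes the grading and keeps the action. *)
Lemma simple_hw_iso : exists f : {linear H -> K}, [/\ bijective f,
    forall y v, part y v -> part (z (+) y) (f v)
  & forall X v, X \in galg -> f (act X v) = act X (f v)].
Proof.
pose f x := projT1 (cid (graph_total x)).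
have gf x : graph x (f x) by rewrite /f; case: cid.
pose g y := projT1 (cid (graph_surjective y)).
have gg y : graph (g y) y by rewrite /g; case: cid.
have uniqf x y : graph x y -> f x = y.
  move=> gxy; apply/eqP; rewrite -subr_eq0; apply/eqP/graph_functional.
  by have := graph_lin (-1) gxy (gf x); rewrite !scaleN1r addNr addrC.
have f_lin : linear f.
  by move=> c x y; apply: uniqf; apply: graph_lin.
pose fL : GRing.isLinear C H K _ f := GRing.isLinear.Build C H K _ f f_lin.
pose F : {linear H -> K} := HB.pack f fL.
exists F; split.
- exists g => [x|y]; last by apply: uniqf; apply: gg.
  apply/eqP; rewrite -subr_eq0; apply/eqP/graph_injective.
  by have := graph_lin (-1) (gf x) (gg (f x)); rewrite !scaleN1r addNr addrC.
- move=> y v pv; have [y0 [y1 [q0 q1 E]]] := part_span (f v).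
  have gv := gf v; rewrite E in gv; rewrite /F /=.
  have [zy|zy] := boolP (z (+) y).
    have pv' : part (~~ z) v by move: zy pv; case: (z) (y) => -[].
    have [|_ gv1] := graph_split (part0 H z) pv' q0 q1; first by rewrite add0r.
    by rewrite (uniqf _ _ gv1).
  have pv' : part z v by move: zy pv; case: (z) (y) => -[].
  have [|gv1 _] := graph_split pv' (part0 H (~~ z)) q0 q1; first by rewrite addr0.
  by rewrite (uniqf _ _ gv1).
- by move=> X v gX; apply: uniqf; apply: graph_act.
Qed.

End Isomorphism.
End HighestWeightModules.

(** * Values of the Casimir operator *)

Section CasimirValues.
Variables (R : realType) (m n : nat) (H : srep R m n).
Local Notation C := R[i].
Local Notation e := (eop H).
Local Notation casimir := (casimir parity e).

Lemma eop_lower_raise lam (v : H) k l : weight_vector e lam v ->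
  e k l (e l k v) = (-1) ^+ (parity k (+) parity l) *: e l k (e k l v)
    + (lam k - (-1) ^+ (parity k (+) parity l) * lam l) *: v.
Proof.
move=> wv; rewrite (@eop_gl_module _ _ _ H) !eqxx scale1r mulr1 !wv scalerA.
rewrite scalerBl addrA /ksign.
by have -> : (parity k (+) parity l) && (parity l (+) parity k) = parity k (+) parity l
  by case: (parity k) (parity l) => -[].
Qed.

Lemma eop_lower_raise_tcoord (mu : weight R m n) (v : H) k l :
    weight_vector e (fun k => mu (hvec R k)) v ->
  psign C parity l *: e k l (e l k v) = psign C parity k *: e l k (e k l v)
    + ((-1) ^+ (parity k (+) parity l) * (tcoord mu k - tcoord mu l)) *: v.
Proof.
move=> wv; rewrite (eop_lower_raise _ _ wv) !weight_hvec -!/(psign C parity _).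
rewrite scalerDr !scalerA psignMr; congr (_ + _ *: _).
by rewrite mulrBr mulrA [psign C parity l * psign C parity k]mulrC psignM mulrBr !mulrA
  psignMr psignM.
Qed.

Lemma casimir_hw (mu : weight R m n) (v : H) : highest_weight_vector pos_st mu v ->
  casimir v = wform (mu + 2%:R *: rho pos_st) mu *: v.
Proof.
move=> hv; have wv := hwv_weight hv; rewrite (casimir_split _ wv) wformE.
rewrite add_lfunE -wformE wform_self rho_st_tvec scalerDl.
congr (_ *: _ + _).
  apply: eq_bigr => k _.
  by rewrite weight_hvec -/(psign C parity k) exprMn psign_sqr mul1r.
rewrite scaler_suml; apply: eq_bigr => k _; rewrite scaler_suml; apply: eq_bigr => l kl.
have kl0 : e k l v = 0.
  by apply: (hwv_raised hv); rewrite ?pos_stE // -val_eqE ltn_eqF.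
by rewrite (eop_lower_raise_tcoord _ _ wv) kl0 !(linear0 (e l k)) !scaler0 add0r addr0.
Qed.

Lemma sum_odd_pairs (V : nmodType) (F : 'I_(m + n) -> 'I_(m + n) -> V) :
    (forall k l, parity k = parity l -> (k < l)%N -> F k l = 0) ->
  \sum_(k < m + n) \sum_(l < m + n | (k < l)%N) F k l
  = \sum_(i < m) \sum_(a < n) F (lshift n i) (rshift m a).
Proof.
move=> F0; rewrite big_split_ord /= [X in _ + X]big1 ?addr0 => [|a _].
  apply: eq_bigr => i _; rewrite big_mkcond big_split_ord /= big1 ?add0r => [|j _].
    by apply: eq_bigr => a _; rewrite ltn_addr.
  by case: ifP => // ij; apply: F0; rewrite ?parity_lshift.
apply: big1 => l al; apply: F0 => //; rewrite parity_rshift.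
by symmetry; rewrite /parity (leq_trans _ (ltnW al)) //= leq_addr.
Qed.

(** Put x = E_ia E_ai v and y = E_ai E_ia v, so x + y = (mu, eps_i - delta_a) v. Once the Casimir
    value is subtracted from the standard one, the pair (i, a) contributes -2y; for i >= p the extra
    sum turns this into 2x. Either way the inner operator is raising for the nonstandard system. *)
Lemma casimir_even_hw (p : nat) (mu : weight R m n) (v : H) c :
    highest_weight_vector pos_even mu v -> casimir v = c *: v ->
  (- c + wform (mu + 2%:R *: rho pos_st) mu
    + 2%:R * \sum_(i < m | (p <= i)%N) \sum_(a < n) wform mu (epsilon i - delta a)) *: v
  = 2%:R *: \sum_(i < m) \sum_(a < n)
      (if (p <= i)%N then e (lshift n i) (rshift m a) (e (rshift m a) (lshift n i) v)
       else - e (rshift m a) (lshift n i) (e (lshift n i) (rshift m a) v)).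
Proof.
move=> hv cv; have wv := hwv_weight hv.
set t := tcoord mu.
rewrite 2!scalerDl scaleNr -cv (casimir_split _ wv) wformE.
rewrite add_lfunE -wformE wform_self rho_st_tvec scalerDl.
have -> : \sum_k psign C parity k * mu (hvec R k) ^+ 2
    = \sum_k (-1) ^+ parity k * tcoord mu k ^+ 2.
  apply: eq_bigr => k _.
  by rewrite weight_hvec -/(psign C parity k) exprMn psign_sqr mul1r.
rewrite opprD addrACA addNr add0r.
rewrite scaler_suml -sumrN -big_split /=.
under eq_bigr do rewrite scaler_suml -sumrN -big_split /=.
rewrite sum_odd_pairs => [|k l pkl kl]; last first.
  have kl0 : e k l v = 0.
    by apply: (hwv_raised hv); rewrite ?pos_evenE ?pkl ?eqxx // -val_eqE ltn_eqF.
  by rewrite (eop_lower_raise_tcoord _ _ wv) kl0 !(linear0 (e l k)) !scaler0 add0r addr0 addNr.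
rewrite -scalerA scaler_suml [X in _ + _ *: X]big_mkcond /= !scaler_sumr -big_split.
apply: eq_bigr => i _ /=.
have -> : (if (p <= i)%N then (\sum_(a < n) wform mu (epsilon i - delta a)) *: v else 0)
    = \sum_(a < n) (if (p <= i)%N then (t (lshift n i) - t (rshift m a)) *: v else 0).
  case: ifP => _; last by rewrite big1.
  rewrite scaler_suml; apply: eq_bigr => a _; rewrite wformC wformE.
  by rewrite -rootw_tvec.
rewrite !scaler_sumr -big_split; apply: eq_bigr => a _ /=.
have := eop_lower_raise_tcoord (lshift n i) (rshift m a) wv.
rewrite /psign parity_lshift parity_rshift /= expr0 expr1 !scale1r !scaleN1r mulN1r scaleNr.
set x := e (lshift n i) (rshift m a) (e (rshift m a) (lshift n i) v).
set y := e (rshift m a) (lshift n i) (e (lshift n i) (rshift m a) v).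
rewrite -/t; set d := (t _ - t _) *: v.
move=> /(congr1 -%R); rewrite opprK opprB => ->.
case: ifP => _; rewrite ?scaler0 ?addr0 ?scaler_nat ?mulr2n opprD opprK.
  by rewrite addrA subrK -addrA [- y + d]addrC.
by rewrite addrAC [d - y]addrC addrK.
Qed.

End CasimirValues.

(** * The standard and nonstandard orders of the coordinates *)

Section NonstandardOrder.
Variables p q n : nat.

Definition eps1 : seq 'I_(p + q + n) := [seq lshift n (lshift q i) | i <- enum 'I_p].
Definition eps2 : seq 'I_(p + q + n) := [seq lshift n (rshift p i) | i <- enum 'I_q].
Definition deltas : seq 'I_(p + q + n) := [seq rshift (p + q) a | a <- enum 'I_n].

Lemma size_eps1 : size eps1 = p. Proof. by rewrite size_map size_enum_ord. Qed.
Lemma size_eps2 : size eps2 = q. Proof. by rewrite size_map size_enum_ord. Qed.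
Lemma size_deltas : size deltas = n. Proof. by rewrite size_map size_enum_ord. Qed.

Lemma mem_eps1 (k : 'I_(p + q + n)) : (k \in eps1) = (k < p)%N.
Proof.
apply/mapP/idP => [[i _ ->]|kp] /=; first exact: ltn_ord.
by exists (Ordinal kp); rewrite ?mem_enum //; apply: val_inj.
Qed.

Lemma mem_eps2 (k : 'I_(p + q + n)) : (k \in eps2) = (p <= k < p + q)%N.
Proof.
apply/mapP/idP => [[i _ ->]|kp] /=; first by rewrite leq_addr ltn_add2l ltn_ord.
have kq : (k - p < q)%N by lia.
by exists (Ordinal kq); rewrite ?mem_enum //; apply: val_inj => /=; lia.
Qed.

Lemma mem_deltas (k : 'I_(p + q + n)) : (k \in deltas) = (p + q <= k)%N.
Proof.
apply/mapP/idP => [[i _ ->]|kp] /=; first by rewrite leq_addr.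
have kq : (k - (p + q) < n)%N by have := ltn_ord k; lia.
by exists (Ordinal kq); rewrite ?mem_enum //; apply: val_inj => /=; lia.
Qed.

Lemma index_eps1 (k : 'I_(p + q + n)) : (k < p)%N -> index k eps1 = k.
Proof.
move=> kp; have kE : k = lshift n (lshift q (Ordinal kp)) by apply: val_inj.
rewrite {1}kE (index_map (f := fun i => lshift n (lshift q i))) ?index_enum_ord //.
by move=> i j [] /val_inj.
Qed.

Lemma index_eps2 (k : 'I_(p + q + n)) :
  (p <= k < p + q)%N -> index k eps2 = (k - p)%N.
Proof.
move=> kp; have kq : (k - p < q)%N by lia.
have kE : k = lshift n (rshift p (Ordinal kq)) by apply: val_inj => /=; lia.
rewrite {1}kE (index_map (f := fun i => lshift n (rshift p i))) ?index_enum_ord //.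
by move=> i j [] /addnI/val_inj.
Qed.

Lemma index_deltas (k : 'I_(p + q + n)) :
  (p + q <= k)%N -> index k deltas = (k - (p + q))%N.
Proof.
move=> kp; have kq : (k - (p + q) < n)%N by have := ltn_ord k; lia.
have kE : k = rshift (p + q) (Ordinal kq) by apply: val_inj => /=; lia.
by rewrite {1}kE (index_map (@rshift_inj _ _)) index_enum_ord.
Qed.

Definition st_seq := eps1 ++ eps2 ++ deltas.
Definition nst_seq := eps1 ++ deltas ++ eps2.

Lemma index_st (k : 'I_(p + q + n)) : index k st_seq = k.
Proof.
rewrite /st_seq !index_cat mem_eps1 mem_eps2 size_eps1 size_eps2.
case: ltnP => [/index_eps1//|pk] /=.
case: ltnP => [kq|kq]; first by rewrite index_eps2 ?pk // subnKC.
by rewrite index_deltas // addnA subnKC.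
Qed.

Lemma index_nst (k : 'I_(p + q + n)) : index k nst_seq =
  if (k < p)%N then (k : nat) else if (k < p + q)%N then (k + n)%N else (k - q)%N.
Proof.
rewrite /nst_seq !index_cat mem_eps1 mem_deltas size_eps1 size_deltas.
case: ltnP => [/index_eps1//|pk].
case: leqP => kq; first by rewrite index_deltas //; lia.
by rewrite index_eps2 ?pk //; lia.
Qed.

(** The nonstandard system comes from a total order of the coordinates, with the deltas between the
    two blocks of epsilons, so positions in [nst_seq] can serve as the rank [r]. *)
Lemma pos_nstE (k l : 'I_(p + q + n)) :
  pos_nst p k l = (index k nst_seq < index l nst_seq)%N.
Proof.
rewrite !index_nst /pos_nst /pos_even.
case: (split_ordP k) => i ->; case: (split_ordP l) => j -> /=;
  have := ltn_ord i; have := ltn_ord j; do ?[case: ifP => ?]; lia.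
Qed.

Lemma uniq_st : uniq st_seq.
Proof.
have uniq_map (T : finType) (f : T -> 'I_(p + q + n)) : injective f -> uniq (map f (enum T)).
  by move=> f_inj; rewrite map_inj_uniq ?enum_uniq.
have u1 : uniq eps1 by apply: uniq_map => i j [] /val_inj.
have u2 : uniq eps2 by apply: uniq_map => i j [] /addnI/val_inj.
have u3 : uniq deltas by apply: uniq_map => i j /rshift_inj.
rewrite !cat_uniq u1 u2 u3 /= andbT.
apply/andP; split; apply/hasPn => k.
  by rewrite mem_cat mem_eps1 mem_eps2 mem_deltas; lia.
by rewrite mem_deltas mem_eps2; lia.
Qed.

Lemma mem_st k : k \in st_seq.
Proof. by rewrite -index_mem index_st size_cat size_cat size_eps1 size_eps2 size_deltas addnA. Qed.

Lemma mem_nst k : k \in nst_seq.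
Proof. by have := mem_st k; rewrite /nst_seq !mem_cat => /or3P[] ->; rewrite ?orbT. Qed.

Lemma index_nst_inj : injective (index^~ nst_seq).
Proof. by move=> k l; apply: (index_inj k); apply: mem_nst. Qed.

End NonstandardOrder.

(** * Unitarity and the nonstandard highest weight vector *)

Section UnitaryForm.
Variables (R : realType) (p q n : nat).
Local Notation C := R[i].

Definition jsign (k : 'I_(p + q + n)) : C := (-1) ^+ (p <= k)%N.

Lemma JmxE : Jmx R p q n = diag_mx (\row_k jsign k).
Proof.
have N1 k : - 1%:M = diag_mx (const_mx (- 1)) :> 'M[C]_k.
  by rewrite diag_const_mx raddfN.
rewrite /Jmx !N1 -!diag_const_mx -!diag_mx_row; congr diag_mx; apply/rowP => k.
rewrite [RHS]mxE /jsign -(splitK k); case: (split k) => [i|a] /=.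
  rewrite row_mxEl -(splitK i); case: (split i) => j /=.
    by rewrite row_mxEl mxE leqNgt ltn_ord.
  by rewrite row_mxEr mxE leq_addr.
by rewrite row_mxEr mxE -addnA leq_addr.
Qed.

Lemma omega_delta k l :
  omega (delta_mx k l) = (jsign k * jsign l) *: delta_mx l k :> 'M[C]_(p + q + n).
Proof.
have JJ : Jmx R p q n *m Jmx R p q n = 1%:M.
  rewrite JmxE mulmx_diag -diag_const_mx; congr diag_mx; apply/rowP => i.
  by rewrite !mxE -expr2 sqrr_sign.
have [Ju _] := mulmx1_unit JJ.
have Jinv : invmx (Jmx R p q n) = Jmx R p q n by rewrite -[RHS](mulKmx Ju) JJ mulmx1.
rewrite /omega Jinv JmxE mul_diag_mx mul_mx_diag; apply/matrixP => i j.
rewrite !mxE rmorph_nat andbC.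
case: andP => [[/eqP-> /eqP->]|_]; first by rewrite !mulr1 mulrC.
by rewrite !mulr0 mul0r.
Qed.

Variables (H : srep R (p + q) n) (form : {dot H for (@Num.conj C)}).
Hypothesis form_omega : forall X (v w : H), X \in sl R (p + q) n ->
  form (act X v) w = form v (act (omega X) w).

(** Off-diagonal units lie in sl(m|n) even when m = n, where invariance is assumed only under
    sl(n|n). *)
Lemma form_eop k l (u w : H) : k != l ->
  form (eop H k l u) w = jsign k * jsign l * form u (eop H l k w).
Proof.
move=> kl; have lk : l != k by rewrite eq_sym.
rewrite eopE // form_omega; last first.
  by rewrite mem_sl supertrace_delta (negPf kl) mulr0.
have sZ : form u (jsign k * jsign l *: eop H l k w) = jsign k * jsign l * form u (eop H l k w).
  by rewrite linearZ /= rmorphM /= !rmorph_sign.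
rewrite omega_delta -sZ eopE //; congr (form u _).
have glk := delta_galg R lk.
have := linearZ_LR (act_on w) (jsign k * jsign l) (delta_mx l k).
by rewrite /= /act_on !glproj_id // memvZ.
Qed.

Lemma form_orth_adj k l (u w : H) : k != l ->
  form u (eop H l k w) = 0 -> form (eop H k l u) w = 0.
Proof. by move=> kl E; rewrite form_eop // E mulr0. Qed.

Lemma form_orthC (u w : H) : form u w = 0 -> form w u = 0.
Proof.
move=> E; have -> : form w u = (-1) ^+ false * (form u w)^* by exact: (hermC form w u).
by rewrite E conjC0 mulr0.
Qed.

Lemma form_orth_lin c (u w x : H) : form u x = 0 -> form w x = 0 -> form (c *: u + w) x = 0.
Proof.
move=> E1 E2; have -> : form (c *: u + w) x = c * form u x + form w x by exact: linearPl.
by rewrite E1 E2 mulr0 addr0.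
Qed.

Lemma form_def (u : H) : form u u = 0 -> u = 0.
Proof.
move=> E; apply/eqP; apply: contraT => /neq0_dnorm_gt0 /=.
by move/(_ _ form); rewrite E ltxx.
Qed.


Lemma form_ge0 (u : H) : 0 <= form u u.
Proof.
have [->|/(neq0_dnorm_gt0 (s := form))/ltW//] := eqVneq u 0.
by have -> : form 0 0 = 0 by exact: linear0l.
Qed.

(** J has equal signs at eps_i and delta_a when i >= p and opposite ones when i < p, which the minus
    sign compensates. Pairing with [v] thus gives a sum of squared norms. *)
Lemma odd_raising_eq0 (v : H) :
    \sum_(i < p + q) \sum_(a < n)
      (if (p <= i)%N
       then eop H (lshift n i) (rshift (p + q) a) (eop H (rshift (p + q) a) (lshift n i) v)
       else - eop H (rshift (p + q) a) (lshift n i) (eop H (lshift n i) (rshift (p + q) a) v)) = 0 ->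
  forall (i : 'I_(p + q)) (a : 'I_n), (if (p <= i)%N then eop H (rshift (p + q) a) (lshift n i) v
               else eop H (lshift n i) (rshift (p + q) a) v) = 0.
Proof.
pose f (i : 'I_(p + q)) (a : 'I_n) := if (p <= i)%N then eop H (rshift (p + q) a) (lshift n i) v
               else eop H (lshift n i) (rshift (p + q) a) v.
have form0 w : form 0 w = 0 by exact: linear0l.
have formD x y w : form (x + y) w = form x w + form y w by exact: linearDl.
move=> /(congr1 (form^~ v)); rewrite form0.
rewrite (big_morph (form^~ v) (fun x y => formD x y v) (form0 v)).
under eq_bigr do rewrite (big_morph (form^~ v) (fun x y => formD x y v) (form0 v)).
have E (i : 'I_(p + q)) (a : 'I_n) : form (if (p <= i)%N
       then eop H (lshift n i) (rshift (p + q) a) (eop H (rshift (p + q) a) (lshift n i) v)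
       else - eop H (rshift (p + q) a) (lshift n i) (eop H (lshift n i) (rshift (p + q) a) v)) v
    = form (f i a) (f i a).
  rewrite /f; case: ifP => pi.
    rewrite form_eop ?eq_lrshift // /jsign /= pi -addnA leq_addr.
    by rewrite -signr_addb mul1r.
  have -> x : form (- x) v = - form x v by exact: linearNl.
  rewrite form_eop ?eq_rlshift // /jsign /= pi -addnA leq_addr.
  by rewrite mulr1 expr1 mulN1r opprK.
under eq_bigr do under eq_bigr do rewrite E.
move=> s0 i a; apply: form_def.
have {}s0 := psumr_eq0P (fun i _ => sumr_ge0 _ (fun a _ => form_ge0 (f i a))) s0.
exact: (psumr_eq0P (fun a _ => form_ge0 (f i a)) (s0 i isT)).
Qed.

End UnitaryForm.

Section OddReflection.
Variables (R : realType) (p q n : nat).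
Local Notation nst_rank := (fun k => index k (nst_seq p q n)).

Definition same_parity {m n} : rel 'I_(m + n) := fun k l => parity k == parity l.

Lemma same_parity_sym m' n' : symmetric (@same_parity m' n').
Proof. by move=> k l; rewrite /same_parity eq_sym. Qed.

Lemma same_parity_trans m' n' : transitive (@same_parity m' n').
Proof. by move=> k l j; rewrite /same_parity => /eqP->. Qed.

Section Representation.
Variable H : srep R (p + q) n.

Lemma hwv_nst_even lam (v : H) :
  highest_weight_vector (pos_nst p) lam v -> highest_weight_vector pos_even lam v.
Proof. by case=> v0 wv rv; split=> // k l kl; apply: rv; rewrite /pos_nst kl. Qed.

Lemma hwv_st_raised lam (v : H) : highest_weight_vector pos_st lam v ->
  raised_to_0 (eop H) full_rel val v.
Proof.
move=> hv k l /andP[_ kl]; apply: (hwv_raised hv); last by rewrite pos_stE.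
by rewrite -val_eqE ltn_eqF.
Qed.

Lemma hwv_nst_raised lam (v : H) : highest_weight_vector (pos_nst p) lam v ->
  raised_to_0 (eop H) full_rel nst_rank v.
Proof.
move=> hv k l /andP[_ kl]; apply: (hwv_raised hv); last by rewrite pos_nstE.
by apply: contraTneq kl => ->; rewrite ltnn.
Qed.

Lemma hwv_even_raised lam (v : H) : highest_weight_vector pos_even lam v ->
  raised_to_0 (eop H) same_parity val v.
Proof.
move=> hv k l /andP[pkl kl]; apply: (hwv_raised hv); last by rewrite pos_evenE kl andbT.
by rewrite -val_eqE ltn_eqF.
Qed.

(* The deltas are moved in front of the last q epsilons by odd reflections. *)
Lemma exists_nst_hwv lam (v : H) z : highest_weight_vector pos_st lam v -> part z v ->
  exists y (mu : weight R (p + q) n) (v' : H), part y v' /\ highest_weight_vector (pos_nst p) mu v'.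
Proof.
move=> hv zv; have [v0 _ _] := hv.
(* Each reflection may change weight and parity, hence the existential form. *)
pose P u := (exists lam', weight_vector (eop H) lam' u) /\ exists z', part z' u.
have [|||||||v' [v'0 [[mu wv'] [y yv']] rv']] :=
  @odd_reflections _ _ parity H (eop H) (@eop_gl_module _ _ _ H) P (eps1 p q n)
    (eps2 p q n) (deltas p q n) v.
- move=> k l u [[lam' wu] [z' zu]]; split.
    by eexists; apply: weight_vector_act wu; exact: eop_gl_module.
  by eexists; apply: part_eop zu.
- by move=> b d; rewrite mem_eps2 mem_deltas /parity; lia.
- exact: uniq_st.
- exact: mem_st.
- move=> i j; rewrite -/(st_seq p q n) !index_st => ij.
  by apply: (hwv_st_raised hv); rewrite /below ij.
- by [].
- by split; [exists (fun k => lam (hvec R k)); apply: hwv_weight hv|exists z].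
exists y, (\sum_k mu k *: coordw R k), v'; split=> //.
apply: hwv_intro => // [k|k l]; first by rewrite pos_nstE ltnn.
by rewrite pos_nstE => /rv'.
Qed.

Lemma even_subrep_stable (W : set H) k l u : even_subrep W -> same_parity k l ->
  W u -> W (eop H k l u).
Proof.
move=> [_ We] /eqP kl Wu; rewrite eop_glproj; apply: We => //; first exact: glproj_galg.
by have := homog_glproj_delta R k l; rewrite kl addbb.
Qed.

Lemma even_subrep_gen lam (v : H) : highest_weight_vector pos_even lam v ->
  even_subrep (gen (eop H) same_parity val v : set H).
Proof.
move=> hv; split=> [|X u gX /homogP X0 gu].
  by split=> [|c x y gx gy]; [exact: gen0|exact: gen_lin].
rewrite act_sum //; elim/big_rec: _ => [|k y _ gy]; first exact: gen0.
apply: genD gy; elim/big_rec: _ => [|l y' _ gy']; first exact: gen0.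
have [kl|kl] := boolP (same_parity k l); last first.
  rewrite X0 ?scale0r ?add0r //; move: kl; rewrite /same_parity.
  by case: (parity k) (parity l) => -[].
apply: gen_lin gy'.
exact: (gen_stable (@eop_gl_module _ _ _ H) (@same_parity_sym _ _)
  (@same_parity_trans _ _) val_inj (hwv_weight hv) (hwv_even_raised hv)).
Qed.

Lemma gen_sub_even_subrep (v : H) (W : set H) : even_subrep W -> W v ->
  forall u, gen (eop H) same_parity val v u -> W u.
Proof.
move=> eW Wv u; have [[_ Wlin] _] := eW.
elim=> // [c x y _ Wx _ Wy|k l x /andP[kl _] _ Wx]; first exact: Wlin.
by apply: even_subrep_stable => //; rewrite same_parity_sym.
Qed.

Variable form : {dot H for (@Num.conj R[i])}.
Hypothesis form_omega : forall X (v w : H), X \in sl R (p + q) n ->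
  form (act X v) w = form v (act (omega X) w).

Let orth u w := form u w = 0.
Let orth0 u : orth 0 u. Proof. exact: linear0l. Qed.

(** Simplicity is [gen_simple] for the even subalgebra: a nonzero even submodule of the span
    contains its highest weight vector. *)
Lemma even_constituent_gen lam (v : H) : highest_weight_vector pos_even lam v ->
  even_constituent (gen (eop H) same_parity val v : set H) lam.
Proof.
move=> hv; split; [exact: even_subrep_gen hv| |by exists v; split=> //; constructor].
move=> W eW Wgen; have [[W0 Wlin] _] := eW.
have [W_eq0|] := pselect (forall u, W u -> u = 0).
  left; apply/seteqP; split=> u; first by move/W_eq0.
  by move=> /= ->.
move=> /existsNP[u0 /not_implyP[Wu0 /eqP u0_neq0]]; right; apply/seteqP; split=> //.
apply: (gen_simple (@eop_gl_module _ _ _ H) (@same_parity_sym _ _) orth0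
  (@form_orth_lin _ _ _ _ _ form) (@form_orthC _ _ _ _ _ form)
  (@form_def _ _ _ _ _ form) (form_orth_adj form_omega)
  (hwv_weight hv) (hwv_even_raised hv) W0 Wlin _ _ Wgen Wu0 u0_neq0) => [k l u|k].
  exact: even_subrep_stable.
by rewrite /same_parity.
Qed.

Lemma casimir_nst_hwv (mu : weight R (p + q) n) (v : H) c :
    highest_weight_vector pos_even mu v -> casimir parity (eop H) v = c *: v ->
  - c + wform (mu + 2%:R *: rho pos_st) mu
    + 2%:R * (\sum_(i < p + q | (p <= i)%N) \sum_(a < n) wform mu (epsilon i - delta a)) = 0
  <-> highest_weight_vector (pos_nst p) mu v.
Proof.
move=> hv cv; have cE := casimir_even_hw p hv cv; have [v0 wv rv] := hv.
split=> [c0|[_ _ rv']]; last first.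
  suff : (- c + wform (mu + 2%:R *: rho pos_st) mu
    + 2%:R * (\sum_(i < p + q | (p <= i)%N) \sum_(a < n) wform mu (epsilon i - delta a))) *: v == 0.
    by rewrite scaler_eq0 (negPf v0) orbF => /eqP.
  rewrite cE big1 ?scaler0 // => i _; rewrite big1 // => a _.
  have lr : lshift n i != rshift (p + q) a by rewrite eq_lrshift.
  have rl : rshift (p + q) a != lshift n i by rewrite eq_rlshift.
  case: ifP => pi; rewrite [eop H _ _ v]eopE // rv' ?linear0 ?oppr0 // pos_nstE !index_nst /=;
    have := ltn_ord i; have := ltn_ord a; do ?[case: ifP => ?]; lia.
move/eqP: cE; rewrite c0 scale0r eq_sym scaler_eq0 pnatr_eq0 /= => /eqP.
move/(odd_raising_eq0 form_omega) => odd0; split=> // k l.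
rewrite /pos_nst => /orP[/rv//|].
have oddE (i j : 'I_(p + q + n)) : i != j -> eop H i j v = 0 -> act (delta_mx i j) v = 0.
  by move=> ij; rewrite eopE.
case: (split_ordP k) => i ->; case: (split_ordP l) => j -> // pi.
  by apply: oddE; rewrite ?eq_lrshift //; have := odd0 i j; rewrite leqNgt pi.
by apply: oddE; rewrite ?eq_rlshift //; have := odd0 j i; rewrite pi.
Qed.

Lemma nst_hwv_unique lam mu (v w : H) z : simple_rep H -> part z v ->
    highest_weight_vector (pos_nst p) lam v -> highest_weight_vector (pos_nst p) mu w ->
  mu = lam /\ exists c, w = c *: v.
Proof.
move=> sH zv hv hw; have [v0 _ _] := hv; have [w0 _ _] := hw.
have := simple_gen (index_nst_inj (n := n)) w sH v0 (hwv_weight hv) (hwv_nst_raised hv) zv.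
move=> /(raised_unique orth0 (@form_orth_lin _ _ _ _ _ form) (@form_orthC _ _ _ _ _ form)
  (@form_def _ _ _ _ _ form)
  (form_orth_adj form_omega) (hwv_nst_raised hv) (hwv_nst_raised hw))[c wE].
by split; [rewrite wE in hw; rewrite (hwv_weight_unique hv hw)|exists c].
Qed.

End Representation.

Lemma simple_parity_pow m' n' e (H : srep R m' n') : simple_rep H -> simple_rep (parity_pow e H).
Proof.
case: e => // -[nz sH]; split=> // W [Ws Wgr Wact]; apply: sH; split=> // v0 v1 p0 p1 Wv.
by have [? ?] := Wgr v1 v0 p1 p0 (eq_ind _ W Wv _ (addrC _ _)).
Qed.

End OddReflection.

Theorem corollary48 (R : realType) (p q n : nat)
    (p_gt0 : (0 < p)%N) (q_gt0 : (0 < q)%N) (n_gt0 : (0 < n)%N)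
    (Lambda : weight R (p + q) n) (L : srep R (p + q) n)
    (L_hw : is_simple_hw L pos_st Lambda) (L_unitary : unitary L) :
  exists (W : set L) (Lambda' : weight R (p + q) n),
    let casimir_eq (mu : weight R (p + q) n) :=
      - wform (Lambda + 2%:R *: rho pos_st) Lambda
      + wform (mu + 2%:R *: rho pos_st) mu
      + 2%:R * (\sum_(i < p + q | (p <= i)%N) \sum_(a < n)
                  wform mu (epsilon i - delta a)) = 0 in
    [/\ even_constituent W Lambda' /\ casimir_eq Lambda',
        forall (W' : set L) (mu : weight R (p + q) n),
          even_constituent W' mu -> casimir_eq mu -> W' = W /\ mu = Lambda'
      & exists e : bool,
          (exists K : srep R (p + q) n, is_simple_hw K (pos_nst p) Lambda') /\
          (forall K : srep R (p + q) n, is_simple_hw K (pos_nst p) Lambda' ->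
             srep_iso L (parity_pow e K))].
Proof.
have [sL [v0 [pv0 hv0]]] := L_hw; have [form [_ form_omega]] := L_unitary.
have [v0_neq0 _ _] := hv0.
have casL u : casimir parity (eop L) u = wform (Lambda + 2%:R *: rho pos_st) Lambda *: u.
  apply: (gen_casimir (@eop_gl_module _ _ _ L) (casimir_hw hv0)).
  exact: (simple_gen val_inj u sL v0_neq0 (hwv_weight hv0) (hwv_st_raised hv0) pv0).
have [e [Lambda' [v [pv hv]]]] := exists_nst_hwv hv0 pv0.
have [v_neq0 _ _] := hv; have hve := hwv_nst_even hv.
exists (gen (eop L) same_parity val v : set L), Lambda'; move=> casimir_eq; split.
- split; first exact: (even_constituent_gen form_omega hve).
  by apply/(casimir_nst_hwv form_omega hve (casL v)).
- move=> W' mu [eW' sW' [w [W'w hw]]] /(casimir_nst_hwv form_omega hw (casL w)) hwn.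
  have [-> [c wE]] := nst_hwv_unique form_omega sL pv hv hwn; split=> //.
  have c0 : c != 0.
    by have [w0 _ _] := hw; apply: contraNneq w0 => c0; rewrite wE c0 scale0r.
  (* Since w = c v with c != 0, W' contains [v] and so the even module it generates; simplicity of
     W' gives equality. *)
  have W'v : W' v.
    have [[W'0 W'lin] _] := eW'.
    by have := W'lin c^-1 w 0 W'w W'0; rewrite addr0 wE scalerA mulVf // scale1r.
  have [W0|<-//] := sW' _ (even_subrep_gen hve) (gen_sub_even_subrep eW' W'v).
  have : (gen (eop L) same_parity val v : set L) v by constructor.
  by rewrite W0 => /= vE; rewrite vE eqxx in v_neq0.
(* [e] is the parity of [v] in L. Shifting the grading by [e] makes [v] even, so L itself then
   provides a model of the nonstandard module. *)
exists e; split.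
  exists (parity_pow e L); split; first exact: simple_parity_pow.
  by case: e pv => pv; exists v.
move=> K [sK [k [pk hk]]]; have [k_neq0 _ _] := hk.
have [f [fbij fpart fact]] := simple_hw_iso (index_nst_inj (n := n)) sL sK v_neq0 k_neq0
  (hwv_weight hv) (hwv_weight hk) (hwv_nst_raised hv) (hwv_nst_raised hk) pv pk.
by case: e fpart {pv} => fpart; exists f; split=> // z u /fpart; case: z.
Qed.
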